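(* Let $G_0$ be a plane graph and let $v_1v_2\cdots v_{2n-1}$ ($n\ge 1$) be a path lying on the boundary of the unbounded face of $G_0$, such that each even-indexed vertex $v_2,v_4,\dots,v_{2n-2}$ has degree two in $G_0$. Let $G$ be obtained from $G_0$ by adding a new leaf $v_0$ adjacent to $v_1$ and a new leaf $v_{2n}$ adjacent to $v_{2n-1}$, both drawn in the unbounded face. For $j=1,\dots,2n$ let $m_j$ denote the edge-vertex of $H_G$ corresponding to the edge $v_{j-1}v_j$ of $G$. Let $$G^+=H_G\setminus\{v_0,v_2,\dots,v_{2n},\,m_1,m_3,\dots,m_{2n-1}\},\qquad G^-=H_G\setminus\{v_0,v_2,\dots,v_{2n},\,m_2,m_4,\dots,m_{2n}\}.$$ Then there is a bijection between the set of perfect matchings of $G^+$ and the set of perfect matchings of $G^-$; in particular $\operatorname{M}(G^+)=\operatorname{M}(G^-)$.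
   Context: All graphs have no loops and no multiple edges; the plane graph $G$ is assumed to have no vertex of degree one inside any bounded face. For a plane graph $G$, its dual refinement $H_G$ is the graph whose vertices are: the vertices of $G$ (original vertices), one vertex for each bounded face of $G$ (face-vertices), and one vertex at the midpoint of each edge of $G$ (edge-vertices). For each edge $e$ of $G$, the edge-vertex of $e$ is joined to the two endpoints of $e$ and to the face-vertex of each bounded face of $G$ whose boundary contains $e$; these are all the edges of $H_G$. Removing a vertex from a graph also removes all edges incident to it. $\operatorname{M}(K)$ denotes the number of perfect matchings of a graph $K$. *)

(* Defs.v *)
From mathcomp Require Import all_boot.

Set Implicit Arguments.
Unset Strict Implicit.
Unset Printing Implicit Defensive.

(** * Finite graphs and perfect matchings *)

(** The vertices of the graph are the elements of [verts]; [link] is only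
    meaningful there, so that deleting vertices amounts to shrinking [verts]. *)
Record graph := Graph {
  carrier : finType;
  verts : {set carrier};
  link : rel carrier }.

Definition edge_set (T : finType) (S : {set T}) (e : rel T) : {set {set T}} :=
  [set [set x; y] | x in S, y in S & e x y].

Definition delete_vertices (K : graph) (X : {set carrier K}) : graph :=
  Graph (verts K :\: X) (@link K).

Definition perfect_matchings (K : graph) : {set {set {set carrier K}}} :=
  [set P | partition P (verts K) & P \subset edge_set (verts K) (@link K)].

Definition M (K : graph) : nat := #|perfect_matchings K|.

(** * Plane graphs *)

(** A graph drawn in the plane is recorded up to homeomorphism by its rotation
    system and its faces: [rot v w] is the neighbour of [v] that follows [w] in
    clockwise order around [v], and [side u v] is the face on the left of the
    edge [uv] when it is traversed from [u] to [v].
    If [v] is isolated, [side v v] is the face that contains [v].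
    These functions are irrelevant at all other arguments. *)
Record drawing := Drawing {
  vertex :> finType;
  adj : rel vertex;
  rot : vertex -> vertex -> vertex;
  face : finType;
  outer : face;
  side : vertex -> vertex -> face }.

Arguments outer : clear implicits.

Section Drawing.
Variable G : drawing.
Implicit Types (u v : G) (f : face G).

Definition degree v : nat := #|[set u | adj v u]|.

Definition edges : {set {set G}} := edge_set [set: G] (@adj G).

(** [corner v u] with [u <> v] stands for the angular sector at [v] that
    follows the edge [vu] clockwise, and also for the directed edge from [u]
    to [v], whose left face contains that sector. The degenerate pair [v], [v]
    is the single corner of an isolated vertex. *)
Definition corner v u : bool := adj v u || (u == v) && (degree v == 0).

(** One step along the boundary of a face, keeping the face on the left. *)
Definition face_step (d : G * G) : G * G := (d.2, rot d.2 d.1).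

Definition boundary_walks : {set {set G * G}} :=
  [set [set d' | fconnect face_step d d'] | d in [pred d | corner d.2 d.1]].

Definition vertex_on_boundary f v : bool :=
  [exists u, corner v u && (side u v == f)].

Definition edge_on_boundary f (e : {set G}) : bool :=
  [exists u, exists v, [&& adj u v, e == [set u; v] & side u v == f]].

Definition n_components : nat := n_comp (@adj G) G.

Definition incident (x y : G + face G) : bool :=
  match x, y with
  | inl u, inl v => adj u v
  | inl v, inr f | inr f, inl v => vertex_on_boundary f v
  | inr _, inr _ => false
  end.

(** The graph may be disconnected. Each component must be embedded in the
    sphere: every component satisfies (vertices) - (edges) + (boundary walks)
    <= 2, so [plane_euler] says that each has genus zero. Each face is bounded
    by several boundary walks when it separates several components; the
    incidence graph between components and faces, whose edges are the boundary
    walks, must be a tree, i.e. connected with one more node than edges. *)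
Record plane : Prop := Plane {
  plane_sym : symmetric (@adj G);
  plane_irrefl : irreflexive (@adj G);
  plane_rot : forall v u, corner v u -> fconnect (rot v) u =1 corner v;
  plane_side : forall v u, corner v u -> side v (rot v u) = side u v;
  plane_euler : #|G| + #|boundary_walks| = #|edges| + 2 * n_components;
  plane_connected : forall x y, connect incident x y;
  plane_tree : n_components + #|face G| = #|boundary_walks| + 1 }.

Definition no_leaf_in_bounded_face : Prop :=
  forall v f, degree v = 1 -> vertex_on_boundary f v -> f = outer G.

(** ** Dual refinement *)

Definition refinement_vertex : finType := (G + face G + {set G})%type.

Definition original_vertex v : refinement_vertex := inl (inl v).
Definition face_vertex f : refinement_vertex := inl (inr f).
Definition edge_vertex (e : {set G}) : refinement_vertex := inr e.

Definition refinement_adj (x y : refinement_vertex) : bool :=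
  match x, y with
  | inr e, inl (inl v) | inl (inl v), inr e => v \in e
  | inr e, inl (inr f) | inl (inr f), inr e => edge_on_boundary f e
  | _, _ => false
  end.

Definition dual_refinement : graph :=
  Graph ([set original_vertex v | v : G]
         :|: [set face_vertex f | f in [pred f | f != outer G]]
         :|: [set edge_vertex e | e in edges])
        refinement_adj.

(** ** Adding a leaf *)

(** The new vertex [None] is joined to [v] inside the corner [corner v u];
    if [v] is isolated, then [u = v]. *)
Definition leaf_adj v (x y : option G) : bool :=
  match x, y with
  | Some a, Some b => adj a b
  | Some a, None | None, Some a => a == v
  | None, None => false
  end.

Definition leaf_rot v u (x y : option G) : option G :=
  match x, y with
  | Some a, Some b => if (a == v) && (b == u) then None else Some (rot a b)
  | Some a, None => if (a == v) && adj v u then Some (rot v u) else None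
  | None, _ => y
  end.

Definition leaf_side v u (x y : option G) : face G :=
  match x, y with
  | Some a, Some b => side a b
  | _, _ => side u v
  end.

Definition add_leaf v u : drawing :=
  Drawing (leaf_adj v) (leaf_rot v u) (outer G) (leaf_side v u).

End Drawing.

Arguments dual_refinement : clear implicits.
Arguments no_leaf_in_bounded_face : clear implicits.

(** * The graphs [G], [G^+] and [G^-] *)

Section TwoLeaves.
Variables (G0 : drawing) (n : nat) (v : nat -> G0).
(** The leaves are added in the corners [corner (v 1) u] and
    [corner (v n.*2.-1) w]; the second corner is one of the graph to which the
    first leaf has already been added. *)
Variables (u : G0) (w : option G0).

Definition one_leaf : drawing := add_leaf (v 1) u.

Definition two_leaves : drawing :=
  @add_leaf one_leaf (Some (v n.*2.-1)) w.

(** The extended path v_0, v_1, ..., v_2n in [two_leaves]. *)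
Definition extended_path (j : nat) : two_leaves :=
  if j == 0 then Some None
  else if j == n.*2 then None
  else Some (Some (v j)).

Definition path_edge_vertex (j : nat) : refinement_vertex two_leaves :=
  edge_vertex [set extended_path j.-1; extended_path j].

Definition even_path_vertices : {set refinement_vertex two_leaves} :=
  [set original_vertex (extended_path i.*2) | i : 'I_n.+1].

Definition Gplus : graph :=
  @delete_vertices (dual_refinement two_leaves)
    (even_path_vertices :|: [set path_edge_vertex i.*2.+1 | i : 'I_n]).

Definition Gminus : graph :=
  @delete_vertices (dual_refinement two_leaves)
    (even_path_vertices :|: [set path_edge_vertex i.*2.+2 | i : 'I_n]).

End TwoLeaves.

(* Main.v *)
(** Write a_0, ..., a_(n-1) for the odd path vertices v_1, v_3, ..., and g_j for
    the inner face next to v_2j (the outer face if j = 0 or j = n). Each surviving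
    path edge can only be matched to one a_i or to one face: g_(i+1) in [G^+] and
    g_i in [G^-]. As in Temperley's bijection, record for a perfect matching the set
    [T] of remaining edges matched to original vertices. For every [T] there is at
    most one matching of either graph, and one exists for [G^+] iff one exists for
    [G^-]; hence the bijection.

    The tools are the coboundaries d p (e) = p(tail) - p(head) for vertex functions
    and d q (e) = q(left) - q(right) for face functions, over the rationals; they are
    orthogonal, and by Euler's formula each space is the whole orthogonal complement
    of the other. A Hall-type count against Euler's formula shows that if some
    matching has type [T], then the vertices are connected through [T] and the path,
    and the faces through the edges outside [T].

    Existence: for fixed [T], a vector in the left kernel of the signed biadjacency
    matrix is a pair (p, q) with p constant along [T], q constant across the other
    edges, and p(a_i) = c_(i+b), where c_j is the jump of q across the path at v_2j.
    Orthogonality of d p and d q then says that the sum of c_(i+b) (c_(i+1) - c_i)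
    vanishes. As c_0 = c_n = 0, this is up to sign half the sum of the squares
    (c_(i+1) - c_i)^2, so c = 0, and connectivity gives p = q = 0.

    Uniqueness: two matchings of type [T] differ by a flow on [T] and a dual flow on
    the other edges, and pairing them yields the same quadratic identity for the
    partial sums of the differences at the a_i. *)

From mathcomp Require Import all_boot all_order fingroup perm all_algebra.
From mathcomp Require Import zify ring.
Require Import Defs.

Set Implicit Arguments.
Unset Strict Implicit.
Unset Printing Implicit Defensive.

Import Order.TTheory GRing.Theory Num.Theory.

(** * Finite sets and finite sums *)

Lemma eq_set2 (T : finType) (a b c d : T) : a != b -> [set a; b] = [set c; d] ->
  (a = c /\ b = d) \/ (a = d /\ b = c).
Proof.
move=> ab E; have := set21 a b; have := set22 a b; rewrite E !inE.
move=> /orP[]/eqP bE /orP[]/eqP aE; [|by right|by left|]; by rewrite aE bE eqxx in ab.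
Qed.

Lemma card_bijection (A B : finType) (X : {set A}) (Y : {set B}) : #|X| = #|Y| ->
  exists phi : {x | x \in X} -> {y | y \in Y}, bijective phi.
Proof.
rewrite -(card_sig (mem X)) -(card_sig (mem Y)) => XY.
exists (fun x => enum_val (cast_ord XY (enum_rank x))).
exists (fun y => enum_val (cast_ord (esym XY) (enum_rank y))) => z.
  by rewrite enum_valK cast_ordK enum_rankK.
by rewrite enum_valK cast_ordKV enum_rankK.
Qed.

Definition sum_set (A B : finType) (X : {set A}) (Y : {set B}) : {set A + B} :=
  [set x | match x with inl a => a \in X | inr b => b \in Y end].

Lemma card_sum_set (A B : finType) (X : {set A}) (Y : {set B}) :
  #|sum_set X Y| = #|X| + #|Y|.
Proof.
rewrite -(card_imset X (@inl_inj A B)) -(card_imset Y (@inr_inj A B)) -cardsUI.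
rewrite [X in _ + X]eq_card0 ?addn0; last first.
  by move=> x; rewrite !inE; apply/negP => /andP[/imsetP[a _ ->] /imsetP[]].
apply: eq_card => -[a|b]; rewrite !inE.
  by rewrite (mem_imset _ _ (@inl_inj A B)) [_ \in inr @: _](_ : _ = false) ?orbF //;
    apply/negP => /imsetP[].
by rewrite (mem_imset _ _ (@inr_inj A B)) [_ \in inl @: _](_ : _ = false) //;
  apply/negP => /imsetP[].
Qed.

Lemma connect_invariant (T : finType) (X : Type) (e : rel T) (h : T -> X) :
  (forall x y, e x y -> h x = h y) -> forall x y, connect e x y -> h x = h y.
Proof.
move=> he x y /connectP[p]; elim: p x => [x _ -> //|z p IHp x] /= /andP[exz pz] ly.
by rewrite (he _ _ exz) (IHp z).
Qed.

Lemma connect_ind (T : finType) (e : rel T) (Q : T -> Prop) x :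
  Q x -> (forall y z, connect e x y -> Q y -> e y z -> Q z) ->
  forall y, connect e x y -> Q y.
Proof.
move=> Qx Qstep y /connectP[p]; elim/last_ind: p y => [y _ -> //|p z IHp y].
rewrite rcons_path last_rcons => /andP[xp pz] ->.
by apply: Qstep pz; [apply/connectP; exists p|apply: IHp].
Qed.

Section Sums.
Local Open Scope ring_scope.

Definition delta (T : eqType) (x y : T) : rat := (y == x)%:R.

Lemma sum_delta (T : finType) (S : {set T}) (p : T -> rat) y :
  \sum_(x in S) p x * delta x y = if y \in S then p y else 0.
Proof.
rewrite /delta; case: ifP => yS.
  rewrite (bigD1 y) //= eqxx mulr1 big1 ?addr0 // => x /andP[_].
  by rewrite eq_sym => /negPf ->; rewrite mulr0.
by apply: big1 => x xS; case: eqP => [E|_]; [rewrite E xS in yS|rewrite mulr0].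
Qed.

Lemma sum_sum_set (A B : finType) (X : {set A}) (Y : {set B}) (h : A + B -> rat) :
  \sum_(x in sum_set X Y) h x = \sum_(a in X) h (inl a) + \sum_(c in Y) h (inr c).
Proof.
by rewrite big_sumType; congr (_ + _); apply: eq_bigl => x; rewrite inE.
Qed.

Lemma sum_halves (k : nat) (h : nat -> rat) :
  \sum_(i < k.*2) h i = \sum_(i < k) (h i.*2 + h i.*2.+1).
Proof.
by elim: k => [|k IHk]; rewrite ?big_ord0 // doubleS !big_ord_recr /= IHk addrA.
Qed.

End Sums.

(** * Linear algebra *)

Section LinearAlgebra.
Local Open Scope ring_scope.
Variable F : fieldType.

(** Linear independence of the rows in [S] over the columns in [E]. Functions on the ambient types
    keep enumerations out of the graph arguments. *)
Definition independent_on (I K : finType) (S : {set I}) (E : {set K})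
    (A : I -> K -> F) :=
  forall p : I -> F, (forall k, k \in E -> \sum_(i in S) p i * A i k = 0) ->
    forall i, i \in S -> p i = 0.

Definition submatrix (I K : finType) (S : {set I}) (E : {set K})
    (A : I -> K -> F) : 'M[F]_(#|S|, #|E|) :=
  \matrix_(i, k) A (enum_val i) (enum_val k).

Lemma rowP_enum_val (I : finType) (S : {set I}) (u : 'rV[F]_#|S|) :
  exists p : I -> F, u = \row_i p (enum_val i).
Proof.
(* The sum has at most one term and is zero off [S], which also covers an empty [S]. *)
exists (fun i => \sum_(j < #|S| | enum_val j == i) u 0 j).
apply/rowP => i; rewrite mxE (bigD1 i) //= big1 ?addr0 // => j.
by move=> /andP[/eqP/enum_val_inj ->]; rewrite eqxx.
Qed.

Lemma submatrix_mulmx (I K : finType) (S : {set I}) (E : {set K}) A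
    (p : I -> F) (k : 'I_#|E|) :
  (\row_i p (enum_val i) *m submatrix S E A) 0 k =
    \sum_(i in S) p i * A i (enum_val k).
Proof. by rewrite mxE [RHS]big_enum_val; apply: eq_bigr => i _; rewrite !mxE. Qed.

Lemma row_free_submatrix (I K : finType) (S : {set I}) (E : {set K}) A :
  independent_on S E A -> row_free (submatrix S E A).
Proof.
move=> indA; rewrite -kermx_eq0; apply/rowV0P => u /sub_kermxP.
have [p ->] := rowP_enum_val u; move=> pA0.
apply/rowP => i; rewrite !mxE; apply: indA (enum_valP i) => k kE.
have := submatrix_mulmx S A p (enum_rank_in kE k).
by rewrite pA0 mxE enum_rankK_in // => <-.
Qed.

Section Orthogonal.
Variables (I J K : finType) (S : {set I}) (U : {set J}) (E : {set K}).
Variables (A : I -> K -> F) (B : J -> K -> F).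
Hypothesis AB0 : forall i j, i \in S -> j \in U -> \sum_(k in E) A i k * B j k = 0.
Hypotheses (indA : independent_on S E A) (indB : independent_on U E B).

Let AB0_mx : submatrix U E B *m (submatrix S E A)^T = 0.
Proof.
apply/matrixP => j i; rewrite !mxE -[RHS](AB0 (enum_valP i) (enum_valP j)).
by rewrite [RHS]big_enum_val; apply: eq_bigr => k _; rewrite !mxE mulrC.
Qed.

(** The rows of [B] lie in the kernel of the transpose of [A], whose dimension is #|E| - #|S|. *)
Lemma orthogonal_card : (#|S| + #|U| <= #|E|)%N.
Proof.
have /mxrankS : (submatrix U E B <= kermx (submatrix S E A)^T)%MS.
  exact/sub_kermxP.
rewrite mxrank_ker mxrank_tr (eqP (row_free_submatrix indA)).
rewrite (eqP (row_free_submatrix indB)).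
have := rank_leq_col (submatrix S E A); rewrite (eqP (row_free_submatrix indA)).
by lia.
Qed.

(** When the dimensions add up, the inclusion of the row space of [B] in that kernel is an
    equality. *)
Lemma orthogonal_span (z : K -> F) : (#|S| + #|U|)%N = #|E| ->
  (forall i, i \in S -> \sum_(k in E) A i k * z k = 0) ->
  exists q : J -> F, forall k, k \in E -> z k = \sum_(j in U) q j * B j k.
Proof.
move=> card_eq Az0.
have BA : (submatrix U E B <= kermx (submatrix S E A)^T)%MS by exact/sub_kermxP.
have AB : (kermx (submatrix S E A)^T <= submatrix U E B)%MS.
  rewrite -(mxrank_leqif_sup BA) mxrank_ker mxrank_tr.
  by rewrite (eqP (row_free_submatrix indA)) (eqP (row_free_submatrix indB)) -card_eq addKn.
have zA : (\row_k z (enum_val k) <= kermx (submatrix S E A)^T)%MS.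
  apply/sub_kermxP/rowP => i; rewrite !mxE -[RHS](Az0 _ (enum_valP i)).
  by rewrite [RHS]big_enum_val; apply: eq_bigr => k _; rewrite !mxE mulrC.
have /submxP[u] := submx_trans zA AB.
have [q ->] := rowP_enum_val u; move=> zq.
exists q => k kE; have := submatrix_mulmx U B q (enum_rank_in kE k).
by rewrite -zq mxE enum_rankK_in.
Qed.

End Orthogonal.

(** A nonzero determinant has a nonzero term in its expansion over permutations, and that
    permutation is the matching. *)
Lemma nonsingular_matching (I J : finType) (i0 : I) (S : {set I}) (C : {set J})
    (A : I -> J -> F) :
  #|S| = #|C| -> independent_on S C A ->
  exists m : J -> I, [/\ {in C &, injective m}, {in C, forall c, m c \in S} &
    {in C, forall c, A (m c) c != 0}].
Proof.
move=> SC /row_free_submatrix; move: {-2}(submatrix S C A) (erefl (submatrix S C A)) => N defN N_free.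
have : \det (castmx (erefl, esym SC) N) != 0.
  rewrite {defN} -unitfE -unitmxE -row_free_unit /row_free.
  (* Once both cardinals are generalised, the cast along their equality becomes the identity. *)
  move: (esym SC) N N_free; move: #|S| #|C| => a b e.
  by case: _ / e => N; rewrite castmx_id.
have [s Ns _|] := pickP (fun s : 'S_#|S| =>
    [forall i, castmx (erefl, esym SC) N i (s i) != 0]); last first.
  move=> noperm /eqP[]; rewrite /determinant big1 // => s _.
  have := noperm s; move=> /negbT; rewrite negb_forall => /existsP[i /negPn/eqP Ni].
  by rewrite (bigD1 i) //= Ni mul0r mulr0.
have [-> |[c0 c0C]] := set_0Vmem C.
  by exists (fun=> i0); split => [c c'|c|c]; rewrite inE.
pose r c := cast_ord (esym SC) (enum_rank_in c0C c).
have rE c : c \in C -> enum_val (cast_ord SC (r c)) = c.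
  by move=> cC; rewrite /r cast_ordKV enum_rankK_in.
exists (fun c => enum_val ((s^-1)%g (r c))); split => [c c' cC c'C|c _|c cC].
- by move=> /enum_val_inj/perm_inj rc; rewrite -(rE c) // rc rE.
- exact: enum_valP.
have := forallP Ns ((s^-1)%g (r c)).
rewrite permKV castmxE defN mxE /= esymK rE //.
by rewrite /= cast_ord_id.
Qed.

End LinearAlgebra.

(* Up to sign, the sum is half the sum of the squares of [c i.+1 - c i]. *)
Lemma closed_telescope_eq0 (F : realFieldType) (n : nat) (c : nat -> F) (b : bool) :
  c 0%N = 0%R -> c n = 0%R ->
  (\sum_(i < n) c (i + b)%N * (c i.+1 - c i) = 0)%R ->
  forall i, (i <= n)%N -> c i = 0%R.
Proof.
move=> c0 cn sum0.
have sq : (\sum_(i < n) (c i.+1 - c i) ^+ 2 = 0)%R.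
  have tele : (\sum_(i < n) (c i.+1 ^+ 2 - c i ^+ 2) = 0)%R.
    rewrite -(big_mkord xpredT (fun i => c i.+1 ^+ 2 - c i ^+ 2))%R.
    by rewrite telescope_sumr // c0 cn subrr.
  have -> : (\sum_(i < n) (c i.+1 - c i) ^+ 2 =
      (-1) ^+ b *+ 2 * - (\sum_(i < n) c (i + b)%N * (c i.+1 - c i))
      + (-1) ^+ (~~ b) * - \sum_(i < n) (c i.+1 ^+ 2 - c i ^+ 2))%R.
    rewrite -!sumrN !mulr_sumr -big_split; apply: eq_bigr => i _.
    by case: (b); rewrite ?addn1 ?addn0 /=; ring.
  by rewrite sum0 tele !oppr0 !mulr0 addr0.
have /psumr_eq0P dc0 := sq.
elim=> [//|i IHi] lt_in.
have /eqP := dc0 (fun i _ => sqr_ge0 _) (Ordinal lt_in) isT.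
by rewrite sqrf_eq0 subr_eq0 => /eqP ->; apply/IHi/ltnW.
Qed.

(** * Plane drawings *)

Lemma edge_setP (T : finType) (S : {set T}) (e : rel T) (D : {set T}) :
  reflect (exists x y, [/\ x \in S, y \in S, e x y & D = [set x; y]]) (D \in edge_set S e).
Proof.
apply: (iffP imset2P) => [[x y xS]|[x [y [xS yS xy ->]]]].
  by rewrite inE => /andP[yS xy] ->; exists x, y.
by exists x y; rewrite // inE yS.
Qed.

Section Plane.
Local Open Scope ring_scope.
Variable G : drawing.
Hypothesis G_plane : plane G.
Implicit Types (u v w x : G) (f : face G) (e : {set G}).

Let adj_sym := plane_sym G_plane.
Let adjxx := plane_irrefl G_plane.

Lemma adj_neq u v : adj u v -> u != v.
Proof. by apply: contraTneq => ->; rewrite adjxx. Qed.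

Lemma edgesP e : reflect (exists u v, adj u v /\ e = [set u; v]) (e \in edges G).
Proof.
apply: (iffP (edge_setP _ _ _)) => [[u [v [_ _ uv ->]]]|[u [v [uv ->]]]]; first by exists u, v.
by exists u, v; rewrite !inE.
Qed.

Lemma adj_edges u v : adj u v -> [set u; v] \in edges G.
Proof. by move=> uv; apply/edgesP; exists u, v. Qed.

Lemma edge_ends e u v : e \in edges G -> u \in e -> v \in e -> u != v ->
  adj u v /\ e = [set u; v].
Proof.
move=> /edgesP[x [y [xy ->]]].
rewrite !in_set2 => /pred2P[]-> /pred2P[]->; rewrite ?eqxx // => _.
by rewrite adj_sym setUC.
Qed.

Lemma edge_on_boundaryP f u v : adj u v ->
  reflect (f = side u v \/ f = side v u) (edge_on_boundary f [set u; v]).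
Proof.
move=> uv; apply: (iffP existsP) => [[x /existsP[y]]|].
  move=> /and3P[xy /eqP/(eq_set2 (adj_neq uv))[][-> ->] /eqP <-]; first by left.
  by right.
move=> [] ->; [exists u|exists v]; apply/existsP; [exists v|exists u].
  by rewrite uv !eqxx.
by rewrite adj_sym uv setUC !eqxx.
Qed.

(** * Coboundaries of vertex and face functions *)

Definition oriented (h : G -> G -> rat) e : rat :=
  if [pick d : G * G | adj d.1 d.2 && (e == [set d.1; d.2])] is Some d
  then h d.1 d.2 else 0.

(** The direction chosen by [pick] is the same for every [h], hence the disjunction outside the
    quantifiers: [vertex_diff] and [face_diff] share their sign, which cancels in products. *)
Lemma orientedP u v : adj u v ->
  (forall h, oriented h [set u; v] = h u v) \/
  (forall h, oriented h [set u; v] = h v u).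
Proof.
move=> uv; rewrite /oriented; case: pickP => [[x y] /= /andP[xy /eqP]|/(_ (u, v))].
  by move=> /(eq_set2 (adj_neq uv))[][-> ->]; [left|right].
by rewrite /= uv eqxx.
Qed.

Definition vertex_diff (p : G -> rat) := oriented (fun u v => p u - p v).
Definition face_diff (q : face G -> rat) :=
  oriented (fun u v => q (side u v) - q (side v u)).

Lemma vertex_diff_eq0 p u v : adj u v ->
  (vertex_diff p [set u; v] == 0) = (p u == p v).
Proof.
by move=> uv; rewrite /vertex_diff; case: (orientedP uv) => ->; rewrite subr_eq0 // eq_sym.
Qed.

Lemma face_diff_eq0 q u v : adj u v ->
  (face_diff q [set u; v] == 0) = (q (side u v) == q (side v u)).
Proof.
by move=> uv; rewrite /face_diff; case: (orientedP uv) => ->; rewrite subr_eq0 // eq_sym.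
Qed.

Lemma diff_mul p q u v : adj u v ->
  vertex_diff p [set u; v] * face_diff q [set u; v] =
    (p u - p v) * (q (side u v) - q (side v u)).
Proof.
by move=> uv; rewrite /vertex_diff /face_diff; case: (orientedP uv) => E; rewrite !E //; ring.
Qed.

(** On this edge [vertex_diff (delta u)] is a unit flow from [u] to [v], signed by the chosen
    direction. *)
Lemma vertex_diff_delta_mul p u v : adj u v ->
  vertex_diff p [set u; v] * vertex_diff (delta u) [set u; v] = p u - p v.
Proof.
move=> uv; have /negPf vu := adj_neq uv; rewrite eq_sym in vu.
rewrite /vertex_diff /delta; case: (orientedP uv) => E; rewrite !E eqxx vu /=; ring.
Qed.

Lemma sum_vertex_diff (S : {set G}) p e :
  \sum_(x in S) p x * vertex_diff (delta x) e =
    vertex_diff (fun x => if x \in S then p x else 0) e.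
Proof.
rewrite /vertex_diff /oriented; case: pickP => [[u v] _ /=|_]; last first.
  by apply: big1 => x _; rewrite mulr0.
by rewrite -!sum_delta -sumrB; apply: eq_bigr => x _; rewrite mulrBr.
Qed.

Lemma sum_face_diff (S : {set face G}) q e :
  \sum_(f in S) q f * face_diff (delta f) e =
    face_diff (fun f => if f \in S then q f else 0) e.
Proof.
rewrite /face_diff /oriented; case: pickP => [[u v] _ /=|_]; last first.
  by apply: big1 => x _; rewrite mulr0.
by rewrite -!sum_delta -sumrB; apply: eq_bigr => x _; rewrite mulrBr.
Qed.

Lemma vertex_diff_delta p e : vertex_diff p e = \sum_x p x * vertex_diff (delta x) e.
Proof.
have := sum_vertex_diff setT p e; rewrite (eq_bigl _ _ (@in_setT _)) => ->.
by rewrite /vertex_diff /oriented; case: pickP => // d _; rewrite !inE.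
Qed.

Lemma face_diff_delta q e : face_diff q e = \sum_f q f * face_diff (delta f) e.
Proof.
have := sum_face_diff setT q e; rewrite (eq_bigl _ _ (@in_setT _)) => ->.
by rewrite /face_diff /oriented; case: pickP => // d _; rewrite !inE.
Qed.

Lemma corner_adj v u w : adj v u -> corner v w = adj v w.
Proof.
move=> vu; rewrite /corner; have -> : degree v == 0%N = false.
  by apply/negbTE; rewrite -lt0n; apply/card_gt0P; exists u; rewrite inE.
by rewrite andbF orbF.
Qed.

Lemma adj_corner v u : adj v u -> corner v u.
Proof. by rewrite /corner => ->. Qed.

Lemma adj_rot v u : adj v u -> adj v (rot v u).
Proof.
move=> vu; rewrite -(corner_adj _ vu) -(plane_rot G_plane (adj_corner vu)).
exact: fconnect1.
Qed.

Lemma rot_onto v u : adj v u -> exists2 w, adj v w & rot v w = u.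
Proof.
move=> vu; have vru := adj_rot vu.
have : fconnect (rot v) (rot v u) u.
  by rewrite (plane_rot G_plane (adj_corner vru)) adj_corner.
move=> /iter_findex; set k := findex _ _ _ => rk.
exists (iter k (rot v) u); last by rewrite -iterS iterSr.
by elim: k {rk} => //= k; apply: adj_rot.
Qed.

Lemma sum_rot v (h : G -> rat) :
  \sum_(u | adj v u) h (rot v u) = \sum_(u | adj v u) h u.
Proof.
pose N := [set u | adj v u].
have rotN : rot v @: N = N.
  apply/setP => u; rewrite [RHS]inE; apply/imsetP/idP => [[w]|].
    by rewrite inE => vw ->; apply: adj_rot.
  by move=> /rot_onto[w vw <-]; exists w; rewrite ?inE.
have inj_rot : {in N &, injective (rot v)} by apply/imset_injP; rewrite rotN.
transitivity (\sum_(u in N) h (rot v u)); first by apply: eq_bigl => u; rewrite inE.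
by rewrite -(big_imset h inj_rot) rotN; apply: eq_bigl => u; rewrite inE.
Qed.

Lemma sum_edges_at v (h : {set G} -> rat) :
  (forall e, e \in edges G -> v \notin e -> h e = 0) ->
  \sum_(e in edges G) h e = \sum_(u | adj v u) h [set v; u].
Proof.
move=> h0; rewrite (bigID (fun e => v \in e)) /= addrC big1 ?add0r; last first.
  by move=> e /andP[]; apply: h0.
pose N := [set u | adj v u].
have inj_set : {in N &, injective (fun u => [set v; u])}.
  move=> u w; rewrite !inE => vu vw /(eq_set2 (adj_neq vu))[][//].
  by move=> vw'; rewrite vw' adjxx in vw.
rewrite -[RHS](eq_bigl _ _ (fun u => in_set (fun u => adj v u) u)).
rewrite -(big_imset h inj_set); apply: eq_bigl => e.
apply/andP/imsetP => [[/edgesP[x [y [xy ->]]]]|[u]].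
  rewrite !inE => /orP[]/eqP vE; first by exists y; rewrite ?inE vE.
  by exists x; [rewrite inE vE adj_sym|rewrite vE setUC].
by rewrite inE => vu ->; rewrite adj_edges // set21.
Qed.

Lemma vertex_diff_notin v e : e \in edges G -> v \notin e ->
  vertex_diff (delta v) e = 0.
Proof.
move=> /edgesP[x [y [xy ->]]]; rewrite !inE negb_or => /andP[vx vy].
apply/eqP; rewrite vertex_diff_eq0 // /delta.
by rewrite ![_ == v]eq_sym (negPf vx) (negPf vy).
Qed.

Lemma face_diff_notin f e : e \in edges G -> ~~ edge_on_boundary f e ->
  face_diff (delta f) e = 0.
Proof.
case/edgesP=> x [y [xy ->]] /(edge_on_boundaryP _ xy) fxy; apply/eqP.
rewrite face_diff_eq0 // /delta.
have [/negPf -> /negPf -> //] : side x y != f /\ side y x != f.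
by split; apply/eqP => E; apply: fxy; rewrite -E; auto.
Qed.

(** By linearity [p] may be the indicator of a vertex [v]. The jumps of [q] met on one turn around
    [v] cancel, since the face behind one edge is the face in front of the next. *)
Lemma diff_orthogonal p q :
  \sum_(e in edges G) vertex_diff p e * face_diff q e = 0.
Proof.
under eq_bigr do rewrite vertex_diff_delta mulr_suml.
rewrite exchange_big big1 // => v _.
under eq_bigr do rewrite -mulrA.
rewrite -mulr_sumr (@sum_edges_at v); last first.
  by move=> e eE ve; rewrite (vertex_diff_notin eE ve) mul0r.
rewrite (eq_bigr (fun u => q (side v u) - q (side u v))); last first.
  move=> u vu; rewrite diff_mul // /delta eqxx.
  by have := adj_neq vu; rewrite eq_sym => /negPf ->; rewrite subr0 mul1r.
rewrite sumrB -(sum_rot v (fun u => q (side v u))).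
rewrite (eq_bigr (fun u => q (side u v))) ?subrr ?mulr0 // => u vu.
by rewrite (plane_side G_plane (adj_corner vu)).
Qed.

Lemma around_const (X : Type) (q : face G -> X) v :
  (forall u, adj v u -> q (side v u) = q (side u v)) ->
  forall u w, corner v u -> corner v w -> q (side u v) = q (side w v).
Proof.
move=> qv u w vu; rewrite -(plane_rot G_plane vu) => /iter_findex <-.
elim: (findex _ _ _) => //= k ->.
have : corner v (iter k (rot v) u).
  by rewrite -(plane_rot G_plane vu) fconnect_iter.
set x := iter k _ _ => vx; rewrite -(plane_side G_plane vx).
have : corner v (rot v x) by rewrite -(plane_rot G_plane vx) fconnect1.
(* The second alternative is an isolated vertex, which has a single corner. *)
by rewrite {1}/corner => /orP[/qv //|/andP[/eqP -> _]].
Qed.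

Lemma side_boundary u v : adj u v ->
  vertex_on_boundary (side u v) u /\ vertex_on_boundary (side u v) v.
Proof.
move=> uv; split; apply/existsP; last first.
  by exists u; rewrite adj_corner ?eqxx // adj_sym.
have [w uw <-] := rot_onto uv; exists w.
by rewrite (plane_side G_plane (adj_corner uw)) adj_corner ?eqxx.
Qed.

Lemma edge_boundary_vertex f e v : e \in edges G -> edge_on_boundary f e ->
  v \in e -> vertex_on_boundary f v.
Proof.
move=> /edgesP[x [y [xy ->]]] /(edge_on_boundaryP _ xy) fxy.
have [] := side_boundary xy; have := side_boundary (etrans (adj_sym y x) xy).
by case: fxy => -> [? ?] ? ?; rewrite !inE => /orP[]/eqP ->.
Qed.

Lemma boundary_const (X : Type) (q : face G -> X) v :
  (forall u, adj v u -> q (side v u) = q (side u v)) ->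
  forall f f', vertex_on_boundary f v -> vertex_on_boundary f' v -> q f = q f'.
Proof.
move=> qv f f' /existsP[u /andP[vu /eqP <-]] /existsP[w /andP[vw /eqP <-]].
exact: around_const.
Qed.

(** * Connected drawings: duality of circulations and face functions *)

Section Connected.
Hypothesis G_conn : n_components G = 1%N.

Lemma adj_connected u v : connect (@adj G) u v.
Proof.
have csym : connect_sym (@adj G) by apply: sym_connect_sym.
rewrite -root_connect //; apply/eqP.
have [x rootsE] := mem_card1 G_conn.
have rootE w : fingraph.root (@adj G) w = x.
  by apply/eqP; have := rootsE (fingraph.root (@adj G) w); rewrite !inE roots_root // => <-.
by rewrite !rootE.
Qed.

Lemma adj_const (X : Type) (p : G -> X) :
  (forall u v, adj u v -> p u = p v) -> forall u v, p u = p v.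
Proof. by move=> /connect_invariant pE u v; apply/pE/adj_connected. Qed.

(** With one component, faces and boundary walks are equally many, which leaves the usual Euler
    formula. *)
Lemma card_edges : (#|edges G| + 2 = #|G| + #|face G|)%N.
Proof.
have := plane_euler G_plane; have := plane_tree G_plane; rewrite G_conn; lia.
Qed.

Lemma face_touches f (v0 : G) : exists v, vertex_on_boundary f v.
Proof.
have /connectP[[|[v|f'] p] //= /andP[fv _] _] := plane_connected G_plane (inr f) (inl v0).
by exists v.
Qed.

Lemma vertex_diff_const p : (forall e, e \in edges G -> vertex_diff p e = 0) ->
  forall u v, p u = p v.
Proof.
move=> p0; apply: adj_const => u v uv.
by apply/eqP; rewrite -vertex_diff_eq0 // p0 ?adj_edges.
Qed.

(** All faces at a vertex have the same value, which defines a function [Q] on the vertices. The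
    ends of an edge share a face, so [Q] is constant by connectivity, and every face touches a
    vertex. *)
Lemma face_diff_const q (v0 : G) : (forall e, e \in edges G -> face_diff q e = 0) ->
  forall f f', q f = q f'.
Proof.
move=> q0.
have qE u v : adj u v -> q (side u v) = q (side v u).
  by move=> uv; apply/eqP; rewrite -face_diff_eq0 // q0 ?adj_edges.
have qv v : forall f f', vertex_on_boundary f v -> vertex_on_boundary f' v -> q f = q f'.
  by apply: boundary_const => u; apply: qE.
have qconst u v f f' : vertex_on_boundary f u -> vertex_on_boundary f' v -> q f = q f'.
  pose Q w := if [pick f | vertex_on_boundary f w] is Some f then q f else 0.
  have QE w g : vertex_on_boundary g w -> q g = Q w.
    by rewrite /Q; case: pickP => [g' g'w gw|/(_ g) -> //]; apply: qv g'w.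
  move=> fu f'v; rewrite (QE _ _ fu) (QE _ _ f'v); apply: adj_const => x y xy.
  by have [sx sy] := side_boundary xy; rewrite -(QE _ _ sx) (QE _ _ sy).
move=> f f'; have [[u fu] [v f'v]] := (face_touches f v0, face_touches f' v0).
exact: qconst fu f'v.
Qed.

(** The coboundary kills only the constants, and these are excluded by the value zero at [v0]. *)
Lemma vertex_diff_independent v0 :
  independent_on [set~ v0] (edges G) (fun x => vertex_diff (delta x)).
Proof.
move=> p p0 x; rewrite !inE => xv0.
have /(_ x v0) := vertex_diff_const (fun e eE => etrans (esym (sum_vertex_diff _ p e)) (p0 e eE)).
by rewrite !inE xv0 eqxx.
Qed.

Lemma face_diff_independent (v0 : G) :
  independent_on [set~ outer G] (edges G) (fun f => face_diff (delta f)).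
Proof.
move=> q q0 f; rewrite !inE => fo.
have /(_ v0 f (outer G)) :=
  @face_diff_const _ ^~ (fun e eE => etrans (esym (sum_face_diff _ q e)) (q0 e eE)).
by rewrite !inE fo eqxx.
Qed.

Let card_diffs v0 : (#|[set~ v0]| + #|[set~ outer G]|)%N = #|edges G|.
Proof.
rewrite !cardsC1; have := card_edges.
have : (0 < #|G|)%N by apply/card_gt0P; exists v0.
have : (0 < #|face G|)%N by apply/card_gt0P; exists (outer G).
lia.
Qed.

(** Here [z] is a circulation. The coboundaries of vertices and of faces are orthogonal, and by
    Euler's formula their dimensions add up to the number of edges. *)
Lemma closed_is_face_diff (v0 : G) (z : {set G} -> rat) :
  (forall p, \sum_(e in edges G) vertex_diff p e * z e = 0) ->
  exists2 q, q (outer G) = 0 & forall e, e \in edges G -> z e = face_diff q e.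
Proof.
move=> z0; have [i j _ _|i _|q zE] := orthogonal_span _ (@vertex_diff_independent v0)
  (face_diff_independent v0) (z := z) (card_diffs v0).
- exact: diff_orthogonal.
- exact: z0.
exists (fun f => if f \in [set~ outer G] then q f else 0); first by rewrite !inE eqxx.
by move=> e eE; rewrite zE // sum_face_diff.
Qed.

(** The dual statement, from the same count with the two families exchanged. *)
Lemma coclosed_is_vertex_diff (v0 : G) (y : {set G} -> rat) :
  (forall q, \sum_(e in edges G) face_diff q e * y e = 0) ->
  exists p, forall e, e \in edges G -> y e = vertex_diff p e.
Proof.
move=> y0; have [i j _ _|i _|p yE] := orthogonal_span _ (face_diff_independent v0)
  (@vertex_diff_independent v0) (z := y) (etrans (addnC _ _) (card_diffs v0)).
- by under eq_bigr do rewrite mulrC; apply: diff_orthogonal.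
- exact: y0.
exists (fun x => if x \in [set~ v0] then p x else 0).
by move=> e eE; rewrite yE // sum_vertex_diff.
Qed.

End Connected.
End Plane.

(** * Matchings along the path *)

Section PathSystem.
Variables (G : drawing) (m : nat) (v : nat -> G).
Hypothesis G_plane : plane G.
Hypothesis v_inj : {in [pred j | 0 < j < m.+1.*2] &, injective v}.
Hypothesis v_path : forall j, 0 < j -> j.+1 < m.+1.*2 -> adj (v j) (v j.+1).
Hypothesis v1_outer : vertex_on_boundary (outer G) (v 1).
Hypothesis e_outer : forall j, 0 < j -> j.+1 < m.+1.*2 ->
  edge_on_boundary (outer G) [set v j; v j.+1].
Hypothesis v_even : forall i, 0 < i -> i < m.+1 -> degree (v i.*2) = 2.

Implicit Types (w x y : G) (f : face G) (e : {set G}) (T : {set {set G}}).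

(** In this section [G] is G_0 and n = m + 1; the 2m edges of the path are numbered from 0. *)
Definition path_edge (k : nat) : {set G} := [set v k.+1; v k.+2].
Definition path_edges := [set path_edge k | k : 'I_m.*2].
Definition even_vertices := [set v i.*2.+2 | i : 'I_m].
Definition root_vertex (i : nat) := v i.*2.+1.

(* The outer face for [j] outside 1..m, and also where the path edges at [v j.*2]
   are bridges with the outer face on both sides. *)
Definition inner_face (j : nat) : face G :=
  if 0 < j < m.+1 then
    if side (v j.*2.-1) (v j.*2) == outer G then side (v j.*2) (v j.*2.-1)
    else side (v j.*2.-1) (v j.*2)
  else outer G.

Lemma adj_path k : k < m.*2 -> adj (v k.+1) (v k.+2).
Proof. by move=> km; apply: v_path; rewrite ?doubleS ?ltnS. Qed.

Lemma eq_path j k : j <= m.*2 -> k <= m.*2 -> v j.+1 = v k.+1 -> j = k.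
Proof. by move=> jm km /v_inj; rewrite !inE doubleS !ltnS => /(_ jm km) []. Qed.

Lemma path_edge_inj : {in 'I_m.*2 &, injective (fun k : 'I_m.*2 => path_edge k)}.
Proof.
move=> j k _ _ /(eq_set2 (adj_neq G_plane (adj_path (ltn_ord j))))[][].
  by move=> /eq_path jk _; apply/val_inj/jk; apply: ltnW.
have := ltn_ord j; have := ltn_ord k => km jm.
by move=> /eq_path jk /eq_path kj; have := jk _ _; have := kj _ _; lia.
Qed.

Lemma path_edges_sub : path_edges \subset edges G.
Proof. by apply/subsetP => _ /imsetP[k _ ->]; apply/adj_edges/adj_path. Qed.

Lemma card_path_edges : #|path_edges| = m.*2.
Proof. by rewrite card_in_imset ?card_ord //; apply: path_edge_inj. Qed.

Lemma card_even_vertices : #|even_vertices| = m.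
Proof.
rewrite card_in_imset ?card_ord // => i j _ _ /eq_path ij; apply/val_inj.
have := ltn_ord i; have := ltn_ord j; have := ij _ _; move=> /=; lia.
Qed.

Lemma even_neighbours i x : i < m ->
  adj (v i.*2.+2) x = (x == v i.*2.+1) || (x == v i.*2.+3).
Proof.
move=> im; have := v_even (ltn0Sn i) (im : i.+1 < m.+1).
have a1 : adj (v i.*2.+2) (v i.*2.+1).
  by rewrite (plane_sym G_plane) adj_path //; lia.
have a3 : adj (v i.*2.+2) (v i.*2.+3) by rewrite adj_path //; lia.
have v13 : v i.*2.+1 != v i.*2.+3.
  by apply/eqP => /eq_path; lia.
move=> deg2; have /eqP : [set v i.*2.+1; v i.*2.+3] == [set x | adj (v i.*2.+2) x].
  rewrite eqEcard cards2 v13 [X in _ && (X <= _)]deg2 andbT.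
  by apply/subsetP => y; rewrite !inE => /orP[]/eqP->.
by move=> /setP/(_ x); rewrite !inE.
Qed.

Lemma even_rot i : i < m ->
  rot (v i.*2.+2) (v i.*2.+1) = v i.*2.+3 /\ rot (v i.*2.+2) (v i.*2.+3) = v i.*2.+1.
Proof.
move=> im; have v13 : v i.*2.+1 != v i.*2.+3 by apply/eqP => /eq_path; lia.
(* A fixed point of the rotation would be its whole cycle, but that cycle contains all
   neighbours. *)
have rotN x y : adj (v i.*2.+2) x -> adj (v i.*2.+2) y -> x != y ->
    rot (v i.*2.+2) x != x.
  move=> ax ay xy; apply: contra_neq xy => rx.
  have : fconnect (rot (v i.*2.+2)) x y.
    by rewrite (plane_rot G_plane (adj_corner ax)) adj_corner.
  move=> /iter_findex <-; by elim: (findex _ _ _) => //= k <-.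
have a1 : adj (v i.*2.+2) (v i.*2.+1) by rewrite even_neighbours ?eqxx.
have a3 : adj (v i.*2.+2) (v i.*2.+3) by rewrite even_neighbours ?eqxx ?orbT.
have := adj_rot G_plane a1; have := adj_rot G_plane a3.
rewrite !even_neighbours // (negPf (rotN _ _ a1 a3 v13)).
rewrite eq_sym in v13; rewrite (negPf (rotN _ _ a3 a1 v13)) orbF.
by move=> /eqP -> /eqP ->.
Qed.

(** The rotation at an even vertex swaps its two neighbours, so both faces continue past it. Hence
    one index per pair of path edges suffices for their sides. *)
Lemma even_side i : i < m ->
  side (v i.*2.+2) (v i.*2.+3) = side (v i.*2.+1) (v i.*2.+2) /\
  side (v i.*2.+3) (v i.*2.+2) = side (v i.*2.+2) (v i.*2.+1).
Proof.
move=> im; have [r1 r3] := even_rot im.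
have c1 : corner (v i.*2.+2) (v i.*2.+1).
  by rewrite adj_corner // even_neighbours ?eqxx.
have c3 : corner (v i.*2.+2) (v i.*2.+3).
  by rewrite adj_corner // even_neighbours ?eqxx ?orbT.
by rewrite -(plane_side G_plane c1) -(plane_side G_plane c3) r1 r3.
Qed.

Definition left_side i := side (v i.*2.+1) (v i.*2.+2).
Definition right_side i := side (v i.*2.+2) (v i.*2.+1).

Lemma path_side k : k < m.*2 ->
  side (v k.+1) (v k.+2) = left_side k./2 /\ side (v k.+2) (v k.+1) = right_side k./2.
Proof.
rewrite /left_side /right_side; move: (odd_double_half k); move: (odd k) k./2 => [] i <- // km.
by apply: even_side; move: km; rewrite /=; lia.
Qed.

Lemma inner_face_sides i : i < m ->
  left_side i = outer G /\ inner_face i.+1 = right_side i \/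
  right_side i = outer G /\ inner_face i.+1 = left_side i.
Proof.
move=> im; have a1 : adj (v i.*2.+1) (v i.*2.+2) by apply: adj_path; lia.
rewrite /inner_face [i.+1 < _]ltnS im /= -/(left_side i) -/(right_side i).
have /(edge_on_boundaryP G_plane _ a1) : edge_on_boundary (outer G) [set v i.*2.+1; v i.*2.+2].
  by apply: e_outer; lia.
by rewrite -/(left_side i) -/(right_side i) => -[] <-; rewrite ?eqxx; [left|case: eqP => [->|]; [left|right]].
Qed.

Lemma edge_on_boundary_path f k : k < m.*2 -> f != outer G ->
  edge_on_boundary f (path_edge k) = (f == inner_face k./2.+1).
Proof.
move=> km fo; have [sl sr] := path_side km; have k2m : k./2 < m by lia.
apply/(edge_on_boundaryP G_plane _ (adj_path km))/eqP; rewrite sl sr.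
  by move: fo; case: (inner_face_sides k2m) => -[-> ->] /eqP fo [].
by case: (inner_face_sides k2m) => -[_ ->]; [right|left].
Qed.

Lemma outer_on_path_edge k : k < m.*2 -> edge_on_boundary (outer G) (path_edge k).
Proof. by move=> km; apply: e_outer; rewrite // doubleS !ltnS. Qed.

Lemma inner_face_touches j : exists2 k, k <= m.*2 & vertex_on_boundary (inner_face j) (v k.+1).
Proof.
case: (ltnP 0 j) => [j0|]; last first.
  by rewrite leqn0 /inner_face => /eqP -> /=; exists 0.
case: (ltnP j m.+1) => jm; last first.
  by rewrite /inner_face [j < _]ltnNge jm andbF; exists 0.
case: j => [//|i] in j0 jm *; rewrite ltnS in jm; exists i.*2; first by lia.
have a1 : adj (v i.*2.+1) (v i.*2.+2) by apply: adj_path; lia.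
have [sl _] := side_boundary G_plane a1.
have [_ sr] := side_boundary G_plane (etrans (plane_sym G_plane _ _) a1).
by case: (inner_face_sides jm) => -[_ ->].
Qed.

(* [inr i] stands for the surviving path edge at [root_vertex i]: the one towards
   [v i.*2.+2] if [b] is true (the graph [G^+]), towards [v i.*2] otherwise. *)
Definition columns : {set {set G} + 'I_m.+1} := sum_set (edges G :\: path_edges) setT.
Definition nodes : {set G + face G} := sum_set (~: even_vertices) [set~ outer G].

(** If [inner_face (i + b)] is the outer face, which is not a node, then [inr i] is forced onto its
    root vertex. *)
Definition incidence (b : bool) (c : {set G} + 'I_m.+1) (x : G + face G) : bool :=
  match c, x with
  | inl e, inl w => w \in e
  | inl e, inr f => edge_on_boundary f e
  | inr i, inl w => w == root_vertex i
  | inr i, inr f => f == inner_face (i + b)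
  end.

Record matching (b : bool) (mu : {set G} + 'I_m.+1 -> G + face G) : Prop := Matching {
  matching_inj : {in columns &, injective mu};
  matching_node : {in columns, forall c, mu c \in nodes};
  matching_incidence : {in columns, forall c, incidence b c (mu c)} }.

Definition vertex_matched (mu : {set G} + 'I_m.+1 -> G + face G) : {set {set G}} :=
  [set e in edges G :\: path_edges | if mu (inl e) is inl _ then true else false].

(** Euler's formula for a possibly disconnected drawing. A perfect matching makes nodes and columns
    equinumerous, which forces a single component. *)
Lemma card_nodes : #|nodes| + 1 = #|columns| + n_components G.
Proof.
have -> : #|nodes| = #|~: even_vertices| + #|face G|.-1 by rewrite card_sum_set cardsC1.
have -> : #|columns| = #|edges G :\: path_edges| + m.+1.
  by rewrite card_sum_set cardsT card_ord.
have : #|edges G :\: path_edges| + m.*2 = #|edges G|.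
  by rewrite -card_path_edges -(cardsID path_edges (edges G)) (setIidPr path_edges_sub) addnC.
have : m + #|~: even_vertices| = #|G|.
  by rewrite -(cardsC even_vertices) card_even_vertices.
have : (0 < #|face G|)%N by apply/card_gt0P; exists (outer G).
have := plane_euler G_plane; have := plane_tree G_plane.
lia.
Qed.

Hypothesis G_conn : n_components G = 1.

(** * Connectivity forced by a matching *)

Section OneMatching.
Variables (b : bool) (mu : {set G} + 'I_m.+1 -> G + face G).
Hypothesis mu_matching : matching b mu.
Let T := vertex_matched mu.

Lemma matching_onto (x : G + face G) : x \in nodes -> exists2 c, c \in columns & mu c = x.
Proof.
have [mu_inj mu_node _] := mu_matching.
have <- : mu @: columns = nodes.
  apply/eqP; rewrite eqEcard; apply/andP; split.
    by apply/subsetP => _ /imsetP[c cC ->]; apply: mu_node.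
  by rewrite -(leq_add2r 1) (card_in_imset mu_inj) card_nodes G_conn.
by case/imsetP => c cC ->; exists c.
Qed.

Lemma vertex_matchedP e : e \in T ->
  exists w, [/\ e \in edges G :\: path_edges, mu (inl e) = inl w, w \in e & w \notin even_vertices].
Proof.
rewrite inE => /andP[eE]; have eC : inl e \in columns by rewrite inE.
have := matching_incidence mu_matching eC; have := matching_node mu_matching eC.
by case: (mu _) => // w; rewrite inE in_setC; exists w.
Qed.

Definition linked : rel G := [rel x y | [set x; y] \in T :|: path_edges].

Lemma linked_edges e : e \in T :|: path_edges -> e \in edges G.
Proof.
rewrite inE => /orP[|/(subsetP path_edges_sub) //].
by rewrite inE => /andP[]; rewrite inE => /andP[].
Qed.

Lemma set2_adj x y : [set x; y] \in edges G -> adj x y.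
Proof.
move=> /edgesP[a [c [ac /esym/(eq_set2 (adj_neq G_plane ac))]]].
by case=> -[<- <-] //; rewrite (plane_sym G_plane).
Qed.

Lemma linked_path k : k <= m.*2 -> connect linked (v 1) (v k.+1).
Proof.
elim: k => [//|k IHk km]; apply: connect_trans (IHk (ltnW km)) (connect1 _).
by apply/setUP; right; apply/imsetP; exists (Ordinal km).
Qed.

Local Open Scope ring_scope.

(* Otherwise let [O] be the component of [v 1]. The edges meeting [O] number at
   least #vertices + #faces - 1 of those meeting [O], as they carry two orthogonal
   independent families; by Euler's formula too few edges remain for the vertices
   and faces away from [O] to be matched. *)
Lemma linked_connected w : connect linked (v 1) w.
Proof.
pose O := [set w | connect linked (v 1) w].
suff: w \in O by rewrite inE.
apply/negPn/negP => wO.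
have pathO k : (k <= m.*2)%N -> v k.+1 \in O by rewrite inE; apply: linked_path.
pose Fout := [set f | [exists x in O, vertex_on_boundary f x]].
pose Eout := [set e in edges G | ~~ [disjoint e & O]].
have boundF x f : x \in O -> vertex_on_boundary f x -> f \in Fout.
  by move=> xO fx; rewrite inE; apply/existsP; exists x; rewrite xO.
have outerF : outer G \in Fout by apply: (boundF (v 1)) => //; apply: (pathO 0%N).
have EoutP x e : e \in edges G -> x \in O -> x \in e -> e \in Eout.
  by move=> eE xO xe; rewrite inE eE; apply/pred0Pn; exists x; rewrite /= xe.
have linkO x y : x \in O -> linked x y -> y \in O.
  by rewrite !inE => v1x /connect1; apply: connect_trans.
have rank_out : (#|O| + #|Fout :\ outer G| <= #|Eout|)%N.
  apply: (@orthogonal_card _ _ _ _ _ _ _ (fun x => vertex_diff (delta x))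
     (fun f => face_diff (delta f))) => [x f xO _|p p0 x xO|q q0 f fU].
  - rewrite -[RHS](diff_orthogonal G_plane (delta x) (delta f)).
    rewrite [RHS](bigID (mem Eout)) /= [X in _ + X]big1 ?addr0; last first.
      move=> e /andP[eE eO]; rewrite vertex_diff_notin ?mul0r //.
      by apply: contraNN eO; apply: EoutP.
    by apply: eq_bigl => e; rewrite inE; case: (e \in edges G); rewrite ?andbF.
  (* The extension of [p] by zero has zero coboundary everywhere and vanishes at [w], which is
     outside [O]. *)
  - have := @vertex_diff_const _ G_plane G_conn (fun x => if x \in O then p x else 0).
    move=> /(_ _ x w); rewrite xO (negPf wO); apply=> e eE.
    case: (boolP (e \in Eout)) => [/p0|]; first by rewrite sum_vertex_diff.
    rewrite inE eE negbK; case/edgesP: eE => y [z [yz ->]] /pred0P yzO.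
    apply/eqP; rewrite vertex_diff_eq0 //.
    have := yzO y; have := yzO z; rewrite /= !inE !eqxx orbT /=.
    by rewrite -![connect _ _ _]in_set => -> ->.
  (* The extension [q'] is constant on the faces around each vertex of [O]. It is zero at [v 1],
     which touches the outer face, and the links carry this zero through [O]. *)
  pose q' f := if f \in Fout :\ outer G then q f else 0.
  have q'v y g h : y \in O -> vertex_on_boundary g y -> vertex_on_boundary h y -> q' g = q' h.
    move=> yO; apply: (boundary_const G_plane) => z yz.
    apply/eqP; rewrite -face_diff_eq0 // -sum_face_diff q0 //.
    by apply: (EoutP y); rewrite ?set21 ?adj_edges.
  have q'0 y : y \in O -> forall g, vertex_on_boundary g y -> q' g = 0.
    rewrite inE; elim/connect_ind: y / => [g gv|y z v1y IHy yz g gz].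
      by rewrite (q'v (v 1) g (outer G)) //; [rewrite /q' !inE eqxx|apply: (pathO 0%N)].
    have yO : y \in O by rewrite inE.
    have ayz := set2_adj (linked_edges yz).
    have [sy sz] := side_boundary G_plane ayz.
    by rewrite (q'v z g (side y z)) ?IHy // (linkO y).
  have fq : q f = q' f by rewrite /q' fU.
  move: fU; rewrite !inE => /andP[_ /existsP[y /andP[yO fy]]].
  by rewrite fq; apply: q'0 fy.
(* Nodes away from [O] can only be matched to edges disjoint from [O]: the surviving path edges
   reach only [O] and faces touching it, and an edge of [T] meeting [O] has both ends in [O]. *)
have match_in : (#|~: O| + #|~: Fout| <= #|edges G :\: Eout|)%N.
  rewrite -card_sum_set.
  apply: leq_trans (leq_imset_card (fun e => mu (inl e)) _).
  apply/subset_leq_card/subsetP => x xI.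
  have : x \in nodes.
    move: xI; rewrite !inE; case: x => [x|f]; rewrite !inE.
      apply: contra => /imsetP[i _ ->]; rewrite -in_set; apply: pathO.
      by have := ltn_ord i; lia.
    by apply: contraNneq => ->; move: outerF; rewrite inE.
  move=> /matching_onto[c cC muc]; have := matching_incidence mu_matching cC.
  rewrite muc; case: c => [e|i] in cC muc *; last first.
    case: x => [x|f] in xI muc * => /eqP xE; move: xI; rewrite inE in_setC xE.
      by rewrite pathO //; have := ltn_ord i; lia.
    by have [k km /boundF->] := inner_face_touches (i + b)%N; rewrite ?pathO.
  move=> inc; apply/imsetP; exists e => //; move: cC; rewrite [_ \in columns]inE in_setD.
  move=> /andP[ePE eE]; rewrite in_setD eE andbT inE eE /= negbK.
  apply/pred0P => y /=; apply/negP => /andP[ye yO].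
  case: x => [x|f] in xI muc inc; move: xI; rewrite inE in_setC => /negP[]; last first.
    exact: boundF yO (edge_boundary_vertex G_plane eE inc ye).
  case: (eqVneq x y) => [-> //|xy]; apply: (linkO y) => //.
  rewrite eq_sym in xy; have [_ eyx] := edge_ends G_plane eE ye inc xy.
  by rewrite /linked /= -eyx !inE eE ePE muc.
(* The two bounds add up to #vertices + #faces - 1 <= #edges, one more than Euler's formula
   allows. *)
have := card_edges G_plane G_conn; have := cardsC O; have := cardsC Fout.
have := cardsD1 (outer G) Fout; rewrite outerF.
have := cardsID Eout (edges G).
have -> : edges G :&: Eout = Eout by apply/setIidPr/subsetP => e; rewrite inE => /andP[].
rewrite -!cardsT; lia.
Qed.

Lemma linked_const (p : G -> rat) :
  (forall e, e \in T :|: path_edges -> vertex_diff p e = 0) -> forall x y, p x = p y.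
Proof.
move=> p0; have pv x : p (v 1) = p x.
  apply: connect_invariant (linked_connected x) => y z yz.
  by apply/eqP; rewrite -vertex_diff_eq0 ?p0 // set2_adj // linked_edges.
by move=> x y; rewrite -pv.
Qed.

(* Otherwise the support [S] of [q] is matched into edges outside [T] with both sides
   in [S]. The boundaries of these edges are independent, since a dual cycle among
   them would be d p with p constant along [T] and the path; but they all lie in a
   hyperplane of Q^S. *)
Lemma face_potential_eq0 (q : face G -> rat) : q (outer G) = 0 ->
  (forall e, e \in edges G -> e \notin T -> face_diff q e = 0) -> forall f, q f = 0.
Proof.
move=> qo q0 f0; apply/eqP/negPn/negP => qf0.
pose S := [set f | q f != 0].
(* A path edge has the outer face, where [q] is zero, on one side. *)
have qpath k : (k < m.*2)%N -> q (inner_face k./2.+1) = 0.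
  move=> km; have pe : path_edge k \in path_edges.
    by apply/imsetP; exists (Ordinal km).
  have /q0 : path_edge k \in edges G by apply: (subsetP path_edges_sub).
  rewrite !inE pe => /(_ isT)/eqP; rewrite face_diff_eq0 ?adj_path //.
  have [-> ->] := path_side km; have k2m : (k./2 < m)%N by lia.
  by case: (inner_face_sides k2m) => -[-> ->]; rewrite qo => /eqP.
have qinner j : q (inner_face j) = 0.
  case: j => [|j]; first by rewrite /inner_face qo.
  case: (ltnP j m) => jm; last first.
    by rewrite /inner_face; have /negPf -> : ~~ (0 < j.+1 < m.+1)%N by lia.
  by have := qpath j.*2; rewrite doubleK; apply; lia.
pose ES := [set e in edges G | (e \notin T) && [exists f in S, edge_on_boundary f e]].
have ES_side e f : e \in ES -> edge_on_boundary f e -> f \in S.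
  rewrite inE => /and3P[eE eT /existsP[g /andP[gS]]].
  have := q0 e eE eT; case/edgesP: eE => x [y [xy ->]] /eqP.
  rewrite face_diff_eq0 // => /eqP qxy; move: gS; rewrite !inE => gS.
  by move=> /(edge_on_boundaryP G_plane _ xy) gxy /(edge_on_boundaryP G_plane _ xy) fxy;
    case: gxy fxy gS => -> [] ->; rewrite ?qxy // -qxy.
have ES_path e : e \in ES -> e \notin T :|: path_edges.
  move=> eES; move: (eES); rewrite inE => /and3P[eE eT _]; rewrite inE (negPf eT) /=.
  apply/negP => /imsetP[k _ ek]; have := ES_side e (outer G) eES.
  by rewrite ek outer_on_path_edge // inE qo eqxx => /(_ isT).
(* The hyperplane is the orthogonal complement of the constant 1 on [S], a family with one row,
   indexed by [unit]. *)
have : (#|ES| + #|[set: unit]| <= #|S|)%N.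
  apply: (@orthogonal_card _ _ _ _ _ _ _ (fun e f => face_diff (delta f) e) (fun _ _ => 1)).
  - move=> e _ eES _; under eq_bigr do rewrite mulrC.
    rewrite (sum_face_diff S (fun=> 1)).
    have /edgesP[x [y [xy exy]]] : e \in edges G by move: eES; rewrite inE => /andP[].
    rewrite exy in eES *; apply/eqP; rewrite face_diff_eq0 //.
    by rewrite !(ES_side [set x; y]) //; apply/(edge_on_boundaryP G_plane _ xy); auto.
  (* A relation [y] among the boundaries, extended by zero, is coclosed, hence the coboundary of
     some [p]; [linked_const] makes [p] constant. *)
  - move=> y y0; pose y' e := if e \in ES then y e else 0.
    have [q'|p pE] := @coclosed_is_vertex_diff _ G_plane G_conn (v 1) y'.
      under eq_bigr do rewrite face_diff_delta mulr_suml.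
      rewrite exchange_big big1 // => f _.
      under eq_bigr do rewrite -mulrA; rewrite -mulr_sumr.
      rewrite (bigID (mem ES)) /= [X in _ + X]big1 ?addr0; last first.
        by move=> e /andP[_ eES]; rewrite /y' (negPf eES) mulr0.
      case: (boolP (f \in S)) => fS; last first.
        rewrite big1 ?mulr0 // => e /andP[eE eES].
        by rewrite (face_diff_notin G_plane) ?mul0r //; apply: contra fS; apply: ES_side.
      rewrite -[RHS](mulr0 (q' f)); congr (_ * _); rewrite -[RHS](y0 f fS).
      rewrite [RHS](eq_bigl (fun e => (e \in edges G) && (e \in ES))); last first.
        by move=> e; rewrite inE; case: (e \in edges G).
      by apply: eq_bigr => e /andP[_ eES]; rewrite /y' eES mulrC.
    have pconst : forall x x', p x = p x'.
      apply: linked_const => e eTP; rewrite -pE ?linked_edges // /y'.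
      by case: ifP => // /ES_path; rewrite eTP.
    move=> e eES; have := pE e; rewrite /y' eES.
    move: eES; rewrite inE => /andP[eE _] /(_ eE) ->.
    by case/edgesP: eE => x [x' [xx' ->]]; apply/eqP; rewrite vertex_diff_eq0 // (pconst x x').
  - move=> r r0 []; have := r0 f0; rewrite inE qf0 => /(_ isT).
    by rewrite (eq_bigl _ _ (@in_setT _)) (bigD1 tt) //= big1 ?addr0 ?mulr1 // => -[].
have : (#|S| <= #|ES|)%N; last by rewrite cardsT card_unit; lia.
rewrite -(card_imset S (@inr_inj G (face G))).
apply: leq_trans (leq_imset_card (fun e => mu (inl e)) _).
apply/subset_leq_card/subsetP => _ /imsetP[f fS ->].
have : inr f \in nodes.
  by rewrite !inE; apply: contraTneq fS => ->; rewrite inE qo eqxx.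
move=> /matching_onto[c cC muc]; have := matching_incidence mu_matching cC.
rewrite muc; case: c => [e|i] in cC muc *; last first.
  by move=> /eqP fE; rewrite inE fE qinner eqxx in fS.
move=> /= fe; apply/imsetP; exists e => //; move: cC; rewrite !inE => /andP[ePE eE].
by rewrite eE muc andbF /=; apply/existsP; exists f; rewrite fS.
Qed.

End OneMatching.

(** * Existence: pairing the coboundaries along the path *)

Local Open Scope ring_scope.
Lemma sum_path_edges (h : {set G} -> rat) :
  \sum_(e in edges G) h e =
    \sum_(e in edges G :\: path_edges) h e + \sum_(k < m.*2) h (path_edge k).
Proof.
rewrite (bigID (mem path_edges)) /= addrC; congr (_ + _).
  by apply: eq_bigl => e; rewrite in_setD andbC.
rewrite -(big_imset h (path_edge_inj)); apply: eq_bigl => e.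
rewrite -/path_edges andb_idl //.
exact: (subsetP path_edges_sub).
Qed.

(** Summation by parts. The two path edges at an even vertex carry the same coefficient, so its
    terms cancel and only root vertices remain. *)
Lemma path_flow (p : G -> rat) (c : nat -> rat) : c 0%N = 0 -> c m.+1 = 0 ->
  \sum_(k < m.*2) c k./2.+1 * (p (v k.+1) - p (v k.+2)) =
    \sum_(i < m.+1) p (root_vertex i) * (c i.+1 - c i).
Proof.
move=> c0 cm; rewrite (sum_halves _ (fun k => c k./2.+1 * (p (v k.+1) - p (v k.+2)))).
rewrite big_ord_recr /= cm.
have -> k : \sum_(i < k) (c i.*2./2.+1 * (p (v i.*2.+1) - p (v i.*2.+2))
    + c i.*2.+1./2.+1 * (p (v i.*2.+2) - p (v i.*2.+3))) =
  \sum_(i < k) p (root_vertex i) * (c i.+1 - c i) - p (root_vertex k) * c k.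
  elim: k => [|k IHk]; first by rewrite !big_ord0 c0 mulr0 subr0.
  rewrite !big_ord_recr /= IHk doubleK uphalf_double /root_vertex doubleS; ring.
by rewrite sub0r mulrN.
Qed.

(** These are the jumps c_j; the value zero at both ends of the range makes the sums along the path
    close up. *)
Definition crossing (q : face G -> rat) (j : nat) : rat :=
  if (0 < j < m.+1)%N then q (left_side j.-1) - q (right_side j.-1) else 0.

Lemma path_diff_mul p q k : (k < m.*2)%N ->
  vertex_diff p (path_edge k) * face_diff q (path_edge k) =
    crossing q k./2.+1 * (p (v k.+1) - p (v k.+2)).
Proof.
move=> km; have [sl sr] := path_side km; rewrite diff_mul ?adj_path // sl sr.
by rewrite /crossing /= (_ : (_ < _)%N = true) 1?mulrC //; lia.
Qed.

Lemma crossing_orthogonal p q :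
  \sum_(e in edges G :\: path_edges) vertex_diff p e * face_diff q e
    + \sum_(i < m.+1) p (root_vertex i) * (crossing q i.+1 - crossing q i) = 0.
Proof.
rewrite -(path_flow p (c := crossing q)) //; last by rewrite /crossing ltnn.
rewrite -[RHS](diff_orthogonal G_plane p q) sum_path_edges; congr (_ + _).
by apply: eq_bigr => k _; rewrite path_diff_mul.
Qed.

(* The sign relating the jump of a face function across the directed path to its
   value on the inner face; it may vary with [j], because the outer face need not stay
   on the same side of the path. *)
Definition outer_sign (j : nat) : rat := (-1) ^+ (left_side j.-1 == outer G).

Lemma crossingE q j : q (outer G) = 0 ->
  crossing q j = outer_sign j * q (inner_face j).
Proof.
move=> qo; rewrite /crossing; case: ifP => [|jF]; last by rewrite /inner_face jF qo mulr0.
case: j => [//|j] /=; rewrite ltnS => jm; rewrite /outer_sign /=.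
case: (inner_face_sides jm) => -[so ->]; rewrite so qo ?eqxx ?expr1; first by ring.
by case: eqP => [->|_]; rewrite ?qo; ring.
Qed.

Lemma sum_matching b mu (h : G + face G -> rat) : matching b mu ->
  \sum_(c in columns) h (mu c) = \sum_(x in nodes) h x.
Proof.
move=> mu_m; have [mu_inj mu_node _] := mu_m.
rewrite -(big_imset h mu_inj) /=; apply: eq_bigl => x.
apply/imsetP/idP => [[c cC ->]|/(matching_onto mu_m)[c cC <-]]; first exact: mu_node.
by exists c.
Qed.

(** The nonzero entries of [K] are at incident pairs of the graph for [b'] that respect the type
    [T]. Its rows are independent, so its determinant has a nonzero term, which is the new
    matching. *)
Lemma matching_shift b b' mu : matching b mu ->
  exists2 mu', matching b' mu' & vertex_matched mu' = vertex_matched mu.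
Proof.
move=> mu_m; set T := vertex_matched mu.
(* The sign in the last entry turns the kernel relation of column [inr i] into p(a_i) = c_(i +
   b'). *)
pose K (x : G + face G) (c : {set G} + 'I_m.+1) : rat := match x, c with
  | inl w, inl e => if e \in T then vertex_diff (delta w) e else 0
  | inr f, inl e => if e \in T then 0 else face_diff (delta f) e
  | inl w, inr i => (w == root_vertex i)%:R
  | inr f, inr i => - outer_sign (i + b') * (f == inner_face (i + b'))%:R
  end.
have cardNC : #|nodes| = #|columns|.
  by apply/eqP; rewrite -(eqn_add2r 1) card_nodes G_conn.
have TE e : e \in T -> e \in edges G :\: path_edges by rewrite inE => /andP[].
have indK : independent_on nodes columns K.
  move=> r r0; pose p w := if w \in ~: even_vertices then r (inl w) else 0.
  pose q f := if f \in [set~ outer G] then r (inr f) else 0.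
  have qo : q (outer G) = 0 by rewrite /q !inE eqxx.
  have pT e : e \in T -> vertex_diff p e = 0.
    move=> eT; have := r0 (inl e); rewrite inE TE // => /(_ isT).
    rewrite sum_sum_set /= eT [X in _ + X]big1 ?addr0 => [|f _]; last by rewrite mulr0.
    by rewrite sum_vertex_diff.
  have qT e : e \in edges G :\: path_edges -> e \notin T -> face_diff q e = 0.
    move=> eE eT; have := r0 (inl e); rewrite inE eE => /(_ isT).
    rewrite sum_sum_set /= (negPf eT) big1 ?add0r => [|w _]; last by rewrite mulr0.
    by rewrite sum_face_diff.
  have pq (i : 'I_m.+1) : p (root_vertex i) = crossing q (i + b').
    apply/eqP; rewrite crossingE // -subr_eq0.
    have := r0 (inr i); rewrite !inE => /(_ isT); rewrite sum_sum_set /= => ri.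
    apply/eqP; rewrite -[RHS]ri; congr (_ + _).
      by under [RHS]eq_bigr do rewrite eq_sym; rewrite [RHS](sum_delta _ (fun w => r (inl w))).
    rewrite -mulNr.
    under [RHS]eq_bigr do rewrite mulrCA [_ == inner_face _]eq_sym.
    rewrite -mulr_sumr; congr (_ * _).
    by rewrite [RHS](sum_delta _ (fun f => r (inr f))).
  have c0 : forall j, (j <= m.+1)%N -> crossing q j = 0.
    apply: (@closed_telescope_eq0 _ _ _ b') => //; first by rewrite /crossing ltnn.
    have := crossing_orthogonal p q; rewrite big1 ?add0r => [sum0|e eE].
      by rewrite -[RHS]sum0; apply: eq_bigr => i _; rewrite pq.
    by case: (boolP (e \in T)) => eT; [rewrite pT ?mul0r|rewrite qT ?mulr0].
  have q0 f : q f = 0.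
    apply: (face_potential_eq0 mu_m) => // e eE eT.
    case: (boolP (e \in path_edges)) => ePE; last by apply: qT; rewrite // inE ePE.
    case/imsetP: ePE eE => k _ -> eE.
    (* Pairing with the coboundary of the indicator of [v k.+1] isolates the jump of [q] over this
       path edge, a vanishing crossing. *)
    have /eqP := path_diff_mul (delta (v k.+1)) q (ltn_ord k).
    have km := ltn_ord k; rewrite c0 ?mul0r ?mulf_eq0; last by lia.
    case/orP => /eqP // /eqP; rewrite vertex_diff_eq0 ?adj_path // /delta eqxx.
    by rewrite [_ == v k.+1]eq_sym (negPf (adj_neq G_plane (adj_path km))).
  have p0 w : p w = 0.
    have rw : p (v 1) = 0 by rewrite (pq ord0) c0 //; case: (b').
    rewrite -rw; apply: (linked_const mu_m) => e; rewrite inE => /orP[/pT //|].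
    case/imsetP => k _ ->; apply/eqP; rewrite vertex_diff_eq0 ?adj_path //; apply/eqP.
    (* Even path vertices are not nodes, so [p] is zero there by truncation; at the root vertices
       [p] equals a vanishing crossing. *)
    have pv j : (j <= m.*2)%N -> p (v j.+1) = 0.
      move=> jm; rewrite -(odd_double_half j); have := jm.
      rewrite -{1}(odd_double_half j); case: (odd j) => /= jm'.
        rewrite /p inE; suff -> : v j./2.*2.+2 \in even_vertices by [].
        have jm2 : (j./2 < m)%N by lia.
        by apply/imsetP; exists (Ordinal jm2).
      have jm2 : (j./2 < m.+1)%N by lia.
      by rewrite (pq (Ordinal jm2)) c0 //=; case: (b'); lia.
    by rewrite !pv //; have := ltn_ord k; lia.
  move=> [w|f]; rewrite inE => xN; first by have := p0 w; rewrite /p xN.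
  by have := q0 f; rewrite /q xN.
have [mu' [mu'_inj mu'_node mu'K]] := nonsingular_matching (inl (v 1)) cardNC indK.
exists mu'.
  split=> // -[e|i] cC; have := mu'K _ cC; have := mu'_node _ cC; case: (mu' _) => [w|f] _ /=.
  - case: ifP => [/TE|]; last by rewrite eqxx.
    rewrite inE => /andP[_ eE]; apply: contraNT => /(vertex_diff_notin G_plane eE) ->.
    by rewrite eqxx.
  - case: ifP => [|_]; first by rewrite eqxx.
    move: cC; rewrite !inE => /andP[_ eE]; apply: contraNT => /(face_diff_notin G_plane eE) ->.
    by rewrite eqxx.
  - by case: (w == _); rewrite ?eqxx.
  - by case: (f == _); rewrite ?mulr0 ?eqxx.
(* The type is preserved because the column of [e] in [K] is zero on faces if [e] is in [T], and on
   vertices otherwise. *)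
apply/setP => e; rewrite inE; case: (boolP (e \in edges G :\: path_edges)) => eE /=; last first.
  by apply/esym/negbTE; apply: contra eE; apply: TE.
have eC : inl e \in columns by rewrite inE.
by have := mu'K _ eC; case: (mu' _) => [w|f] /=; case: ifP => //; rewrite eqxx.
Qed.

(** * Uniqueness: comparing two matchings of the same type *)

Definition at_root (mu : {set G} + 'I_m.+1 -> G + face G) (i : 'I_m.+1) : bool :=
  if mu (inr i) is inl _ then true else false.

Definition set_linked T : rel G := [rel x y | [set x; y] \in T].

(** The component of [T] with canonical root [x0], empty if [x0] is no such root: a sum over all
    [x0] meets every component exactly once. *)
Definition linked_class T x0 : {set G} := [set x | fingraph.root (set_linked T) x == x0].

Lemma set_linked_sym T : connect_sym (set_linked T).
Proof. by apply: sym_connect_sym => x y; rewrite /set_linked /= setUC. Qed.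

Lemma linked_class_edge T x0 x y : [set x; y] \in T ->
  (x \in linked_class T x0) = (y \in linked_class T x0).
Proof.
move=> xyT; rewrite !inE; congr (_ == _); apply/eqP.
by rewrite root_connect ?connect1 //; apply: set_linked_sym.
Qed.

Lemma vertex_matched_edges mu e : e \in vertex_matched mu -> e \in edges G.
Proof. by rewrite inE => /andP[]; rewrite inE => /andP[]. Qed.

(* A component of [T] has at least (number of vertices) - 1 edges. *)
Lemma at_most_one_root b mu x0 : matching b mu ->
  (#|[set i : 'I_m.+1 | (root_vertex i \in linked_class (vertex_matched mu) x0) && at_root mu i]| <= 1)%N.
Proof.
move=> mu_m; set T := vertex_matched mu; set C := linked_class T x0; set R := [set i | _].
have [C0|[x1 x1C]] := set_0Vmem C.
  by rewrite (_ : R = set0) ?cards0 //; apply/setP => i; rewrite in_set C0 !inE.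
pose TC := [set e in T | if mu (inl e) is inl w then w \in C else false].
have TC_C e x : e \in T -> x \in C -> x \in e -> e \in TC.
  move=> eT xC xe; rewrite inE eT /=; have [w [_ -> we _]] := vertex_matchedP mu_m eT.
  case/edgesP: (vertex_matched_edges eT) (eT) we xe => s [t [st ->]] stT.
  have sC := linked_class_edge x0 stT; rewrite -/C in sC.
  by rewrite !in_set2 => /orP[]/eqP-> /orP[]/eqP E; move: xC; rewrite E ?sC.
(* The second family is empty, so this is just the rank bound for the vertices of [C] other than
   [x1]. *)
have TC_rank : (#|C :\ x1| + #|(set0 : {set unit})| <= #|TC|)%N.
  apply: (@orthogonal_card _ _ _ _ _ _ _ (fun x => vertex_diff (delta x)) (fun _ _ => 0)).
  - by move=> x i _; rewrite inE.
  - move=> p p0 x xC; pose p' x := if x \in C :\ x1 then p x else 0.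
    have pC : (if x \in C then p' x else 0) = (if x1 \in C then p' x1 else 0).
      apply: (@connect_invariant _ _ (set_linked T) (fun x => if x \in C then p' x else 0)) => [y z yz|]; last first.
        rewrite -root_connect; last exact: set_linked_sym.
        by move: xC x1C; rewrite !inE => /andP[_ /eqP ->] /eqP ->.
      have := linked_class_edge x0 yz; rewrite -/C => <-; case: ifP => // yC.
      have yzTC : [set y; z] \in TC by apply: TC_C yC _; rewrite ?set21.
      apply/eqP; rewrite -vertex_diff_eq0 -?sum_vertex_diff ?p0 //.
      by apply: set2_adj; apply: (@vertex_matched_edges mu).
    move: pC; rewrite /p' xC x1C !inE eqxx /=.
    by move: xC; rewrite !inE => /andP[_ ->].
  - by move=> r _ i; rewrite inE.
have : (#|sum_set TC R| <= #|C|)%N.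
  have sub : sum_set TC R \subset columns.
    apply/subsetP => -[e|i]; rewrite !inE // => /andP[/andP[/andP[-> ->] _] _] //.
  rewrite -(card_in_imset (sub_in2 (subsetP sub) (matching_inj mu_m))).
  rewrite -(card_imset C (@inl_inj G (face G))); apply/subset_leq_card/subsetP => _ /imsetP[c cS ->].
  have := matching_incidence mu_m (subsetP sub _ cS); move: cS; case: c => [e|i]; rewrite inE.
    rewrite inE => /andP[_]; case: (mu _) => // w wC _; exact: imset_f.
  rewrite inE /at_root => /andP[rC]; case: (mu _) => // w _ /eqP ->; exact: imset_f.
move: TC_rank; rewrite card_sum_set cards0 (cardsD1 x1 C) x1C; lia.
Qed.

Section TwoMatchings.
Variables (b : bool) (mu nu : {set G} + 'I_m.+1 -> G + face G).
Hypotheses (mu_m : matching b mu) (nu_m : matching b nu).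
Hypothesis vertex_matched_eq : vertex_matched mu = vertex_matched nu.
Let T := vertex_matched mu.

Definition root_shift (i : 'I_m.+1) : rat := (at_root mu i)%:R - (at_root nu i)%:R.

Lemma T_path e : e \in T -> e \in path_edges = false.
Proof. by rewrite inE => /andP[]; rewrite inE => /andP[/negPf]. Qed.

Lemma T_ends e : e \in T -> exists x y,
  [/\ mu (inl e) = inl x, nu (inl e) = inl y, x \in e & y \in e].
Proof.
move=> eT; have [x [_ mux xe _]] := vertex_matchedP mu_m eT.
have [|y [_ nuy ye _]] := vertex_matchedP nu_m (e := e); first by rewrite -vertex_matched_eq.
by exists x, y.
Qed.

Lemma face_ends e : e \in edges G :\: path_edges -> e \notin T -> exists f g,
  [/\ mu (inl e) = inr f, nu (inl e) = inr g, edge_on_boundary f e & edge_on_boundary g e].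
Proof.
move=> eE eT; have eC : inl e \in columns by rewrite inE.
have := matching_incidence mu_m eC; have := matching_incidence nu_m eC.
have : e \notin vertex_matched nu by rewrite -vertex_matched_eq.
move: eT; rewrite !inE -[~~ _ && _]in_setD eE /=.
by case: (mu _) => // f; case: (nu _) => // g _ _ ge fe; exists f, g.
Qed.

(** The difference of the matchings as a flow: an edge that [mu] gives to [x] and [nu] to [y]
    carries one unit from [x] to [y]. [face_flow] is the dual version. *)
Definition vertex_flow e : rat :=
  match mu (inl e), nu (inl e) with
  | inl x, inl y => if x == y then 0 else vertex_diff (delta x) e
  | _, _ => 0
  end.

Definition face_flow e : rat :=
  match mu (inl e), nu (inl e) with
  | inr f, inr g => if f == g then 0 else face_diff (delta f) e
  | _, _ => 0
  end.

Definition vertex_value (p : G -> rat) (x : G + face G) : rat :=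
  if x is inl w then p w else 0.
Definition face_value (q : face G -> rat) (x : G + face G) : rat :=
  if x is inr f then q f else 0.

Lemma vertex_flowE p e : e \in T ->
  vertex_diff p e * vertex_flow e = vertex_value p (mu (inl e)) - vertex_value p (nu (inl e)).
Proof.
move=> eT; have [x [y [mux nuy xe ye]]] := T_ends eT; rewrite /vertex_flow mux nuy /=.
case: eqVneq => [->|xy]; first by rewrite mulr0 subrr.
have [axy ->] := edge_ends G_plane (vertex_matched_edges eT) xe ye xy.
exact: vertex_diff_delta_mul.
Qed.

Lemma face_flowE q e : e \in edges G :\: path_edges -> e \notin T ->
  face_diff q e * face_flow e = face_value q (mu (inl e)) - face_value q (nu (inl e)).
Proof.
move=> eE eT; have [f [g [muf nug]]] := face_ends eE eT.
rewrite /face_flow muf nug /=; move: eE; rewrite inE => /andP[_ /edgesP[s [t [st ->]]]].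
case: eqVneq => [->|fg]; first by rewrite mulr0 subrr.
have dE c d : c != d -> (c = side s t /\ d = side t s \/ c = side t s /\ d = side s t) ->
    face_diff q [set s; t] * face_diff (delta c) [set s; t] = q c - q d.
  rewrite /face_diff /delta => cd cdE; have dc : d != c by rewrite eq_sym.
  case: (orientedP G_plane st) => E; rewrite !E;
    by case: cdE => -[cE dE]; rewrite -cE -dE eqxx (negPf dc) /=; ring.
move=> /(edge_on_boundaryP G_plane _ st) fE /(edge_on_boundaryP G_plane _ st) gE.
by apply: dE => //; case: fE gE fg => -> [] ->; rewrite ?eqxx //; auto.
Qed.

Lemma sum_columns (h : {set G} + 'I_m.+1 -> rat) :
  \sum_(c in columns) h c =
    \sum_(e in T) h (inl e) + \sum_(e in edges G :\: path_edges | e \notin T) h (inl e)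
      + \sum_i h (inr i).
Proof.
rewrite sum_sum_set (bigID (mem T)) /=; congr (_ + _ + _).
  by apply: eq_bigl => e; rewrite andb_idl // inE => /andP[].
by apply: eq_bigl => i; rewrite inE.
Qed.

(** Both matchings cover every node once, so a function on the nodes has the same total over either.
    The same reason gives [face_balance]. *)
Lemma vertex_balance p :
  \sum_(e in T) (vertex_value p (mu (inl e)) - vertex_value p (nu (inl e)))
    + \sum_(i < m.+1) p (root_vertex i) * root_shift i = 0.
Proof.
have := sum_matching (vertex_value p) mu_m.
rewrite -(sum_matching (vertex_value p) nu_m) => /eqP; rewrite -subr_eq0 -sumrB.
rewrite sum_columns [X in _ + X + _]big1 ?addr0 => [/eqP sum0|e /andP[eE eT]].
  rewrite -[RHS]sum0; congr (_ + _); apply: eq_bigr => i _.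
  have iC : inr i \in columns by rewrite !inE.
  have := matching_incidence mu_m iC; have := matching_incidence nu_m iC.
  rewrite /root_shift /at_root; case: (mu _) => [x|f]; case: (nu _) => [y|g] /=;
    by move=> /eqP E1 /eqP E2; rewrite ?E1 ?E2; ring.
by have [f [g [-> -> _ _]]] := face_ends eE eT; rewrite subrr.
Qed.

Lemma face_balance q :
  \sum_(e in edges G :\: path_edges | e \notin T)
      (face_value q (mu (inl e)) - face_value q (nu (inl e)))
    = \sum_(i < m.+1) q (inner_face (i + b)) * root_shift i.
Proof.
have := sum_matching (face_value q) mu_m.
rewrite -(sum_matching (face_value q) nu_m) => /eqP; rewrite -subr_eq0 -sumrB.
rewrite sum_columns big1 ?add0r => [|e eT]; last first.
  by have [x [y [-> -> _ _]]] := T_ends eT; rewrite subrr.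
rewrite addr_eq0 => /eqP ->; rewrite -sumrN; apply: eq_bigr => i _.
have iC : inr i \in columns by rewrite !inE.
have := matching_incidence mu_m iC; have := matching_incidence nu_m iC.
rewrite /root_shift /at_root; case: (mu _) => [x|f]; case: (nu _) => [y|g] /=;
  by move=> /eqP E1 /eqP E2; rewrite ?E1 ?E2; ring.
Qed.

Lemma face_balance_closed q :
  (forall e, e \in edges G :\: path_edges -> e \notin T -> face_diff q e = 0) ->
  \sum_(i < m.+1) q (inner_face (i + b)) * root_shift i = 0.
Proof.
move=> q0; rewrite -face_balance big1 // => e /andP[eE eT].
by rewrite -face_flowE // q0 // mul0r.
Qed.

(** The flow that has to run along the path through v_2j in order to close up the flow of one
    component. *)
Definition partial_shift x0 (j : nat) : rat :=
  \sum_(i < m.+1 | (i < j)%N) (root_vertex i \in linked_class T x0)%:R * root_shift i.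

Lemma partial_shift0 x0 : partial_shift x0 0 = 0.
Proof. by rewrite /partial_shift big_pred0. Qed.

Lemma partial_shiftS x0 (i : 'I_m.+1) : partial_shift x0 i.+1 - partial_shift x0 i =
  (root_vertex i \in linked_class T x0)%:R * root_shift i.
Proof.
rewrite /partial_shift (bigD1 i) //= (eq_bigl (fun k : 'I_m.+1 => (k < i)%N)) ?addrK // => k.
by rewrite ltnS (leq_eqVlt k) -val_eqE /=; case: ltngtP.
Qed.

Lemma class_const x0 e : e \in T ->
  vertex_diff (fun x => (x \in linked_class T x0)%:R) e = 0.
Proof.
move=> eT; case/edgesP: (vertex_matched_edges eT) (eT) => x [y [xy ->]] xyT.
by apply/eqP; rewrite vertex_diff_eq0 // (linked_class_edge x0 xyT).
Qed.

(** In one component both matchings use equally many roots: its indicator is constant along [T], so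
    [vertex_balance] leaves only the roots. *)
Lemma partial_shift_last x0 : partial_shift x0 m.+1 = 0.
Proof.
rewrite -[RHS](vertex_balance (fun x => (x \in linked_class T x0)%:R)).
rewrite big1 ?add0r => [|e eT]; last by rewrite -vertex_flowE // class_const // mul0r.
by rewrite /partial_shift; apply: eq_bigl => i; rewrite ltn_ord.
Qed.

(* Restricting to one [T]-component keeps the partial sums of constant sign, so the
   unknown signs [outer_sign] can be removed by passing to absolute values. *)
Lemma partial_shift_sign x0 : exists2 s : rat, s != 0 &
  forall j, `|partial_shift x0 j| = s * partial_shift x0 j.
Proof.
pose A mu j := [set i : 'I_m.+1 | (root_vertex i \in linked_class T x0) && at_root mu i & (i < j)%N].
have shiftE j : partial_shift x0 j = #|A mu j|%:R - #|A nu j|%:R.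
  rewrite -!sum1_card !natr_sum /partial_shift.
  under [in RHS]eq_bigl do rewrite inE andbC.
  under [X in _ = _ - X]eq_bigl do rewrite inE andbC.
  rewrite !big_mkcondr -sumrB; apply: eq_bigr => i _; rewrite /root_shift.
  by case: (_ \in _); case: (at_root mu i); case: (at_root nu i); rewrite /=; ring.
have Amono mu' j k : (j <= k)%N -> (#|A mu' j| <= #|A mu' k|)%N.
  move=> jk; apply/subset_leq_card/subsetP => i; rewrite !inE => /andP[-> ij].
  exact: leq_trans ij jk.
have A1 mu' j : matching b mu' -> vertex_matched mu' = T -> (#|A mu' j| <= 1)%N.
  move=> mu'_m TE; apply: leq_trans (at_most_one_root x0 mu'_m).
  by rewrite TE; apply/subset_leq_card/subsetP => i; rewrite !inE => /andP[].
have Amu j := A1 mu j mu_m erefl; have Anu j := A1 nu j nu_m (esym vertex_matched_eq).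
(* Both counts grow from 0 to at most 1, so the one that is ahead somewhere is never behind. *)
have [/forallP ge0|/forallPn[j0]] := boolP [forall j : 'I_m.+2, (#|A nu j| <= #|A mu j|)%N].
  exists 1; rewrite // => j; rewrite mul1r ger0_norm // shiftE subr_ge0 ler_nat.
  have E mu' : A mu' j = A mu' (minn j m.+1).
    by apply/setP => i; rewrite !inE leq_min ltn_ord andbT.
  by have jm : (minn j m.+1 < m.+2)%N by [lia]; have := ge0 (Ordinal jm); rewrite /= -!E.
rewrite -ltnNge => lt0; exists (-1); rewrite // => j; rewrite mulN1r ler0_norm //.
rewrite shiftE subr_le0 ler_nat.
have := Amu j; have := Anu j; have := Amu j0; have := Anu j0.
by have [/ltnW jj|jj] := ltnP j j0; have := Amono mu _ _ jj; have := Amono nu _ _ jj; lia.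
Qed.

(* The flow of one component, closed up along the path. *)
Definition closed_flow x0 e : rat :=
  if e \in T then
    (if mu (inl e) is inl x then (x \in linked_class T x0)%:R else 0) * vertex_flow e
  else \sum_(k < m.*2 | e == path_edge k)
    partial_shift x0 k./2.+1 * vertex_diff (delta (v k.+1)) e.

Lemma closed_flow_path x0 (k : 'I_m.*2) :
  closed_flow x0 (path_edge k) =
    partial_shift x0 k./2.+1 * vertex_diff (delta (v k.+1)) (path_edge k).
Proof.
have kP : path_edge k \in path_edges by apply: imset_f.
rewrite /closed_flow ifN; last by apply/negP => /T_path; rewrite kP.
rewrite (bigD1 k) //= big1 ?addr0 // => k' /andP[/eqP/path_edge_inj kk'].
by rewrite kk' ?eqxx.
Qed.

Lemma closed_flow_off x0 e : e \in edges G :\: path_edges -> e \notin T ->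
  closed_flow x0 e = 0.
Proof.
rewrite inE /closed_flow => /andP[/imsetP ePE _] /negPf ->.
by rewrite big_pred0 // => k; apply/eqP => ek; apply: ePE; exists k.
Qed.

(** By [path_flow] the part along the path contributes the increments of [partial_shift], which are
    the root shifts that [vertex_balance] requires. *)
Lemma closed_flow_closed x0 p :
  \sum_(e in edges G) vertex_diff p e * closed_flow x0 e = 0.
Proof.
pose pC x := (x \in linked_class T x0)%:R * p x.
rewrite sum_path_edges (bigID (mem T)) /= [X in _ + X + _]big1 ?addr0; last first.
  by move=> e /andP[eE eT]; rewrite closed_flow_off ?mulr0.
rewrite -[RHS](vertex_balance pC); congr (_ + _).
  apply: eq_big => [e|e /andP[_ eT]]; first by rewrite andb_idl // inE => /andP[].
  have [x [y [mux nuy xe ye]]] := T_ends eT.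
  rewrite /closed_flow eT mulrCA vertex_flowE // mux nuy /= /pC.
  suff -> : (y \in linked_class T x0) = (x \in linked_class T x0) by ring.
  case/edgesP: (vertex_matched_edges eT) (eT) xe ye => s [t [st ->]] /(linked_class_edge x0) stC.
  by rewrite !in_set2 => /orP[]/eqP -> /orP[]/eqP ->; rewrite ?stC.
under eq_bigr do rewrite closed_flow_path mulrCA (vertex_diff_delta_mul G_plane) ?adj_path //.
rewrite (path_flow p (partial_shift0 x0) (partial_shift_last x0)).
by apply: eq_bigr => i _; rewrite partial_shiftS mulrCA mulrA.
Qed.

(** The closed flow is the coboundary of a face function [q] whose crossings are the partial sums.
    Both [q] and its absolute value are constant across the edges outside [T] and the path, so
    [face_balance_closed] applies to the latter. *)
Lemma partial_shift_orthogonal x0 :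
  \sum_(i < m.+1) partial_shift x0 (i + b) * root_shift i = 0.
Proof.
have [q qo qE] := closed_is_face_diff G_plane G_conn (v 1) (closed_flow_closed x0).
have q_off e : e \in edges G :\: path_edges -> e \notin T -> face_diff q e = 0.
  by move=> eE eT; rewrite -qE ?closed_flow_off //; move: eE; rewrite inE => /andP[].
have crossE j : crossing q j = partial_shift x0 j.
  rewrite /crossing; case: j => [|j] /=; first by rewrite partial_shift0.
  case: ifP => jm; last first.
    rewrite -[LHS](partial_shift_last x0); apply: eq_bigl => i.
    by rewrite ltn_ord (leq_trans (ltn_ord i)) // leqNgt jm.
  have km : (j.*2 < m.*2)%N by lia.
  have := path_diff_mul (delta (v j.*2.+1)) q km.
  rewrite -qE; last by apply: (subsetP path_edges_sub); apply: (imset_f _ (x := Ordinal km)).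
  rewrite (closed_flow_path x0 (Ordinal km)) /= mulrCA (vertex_diff_delta_mul G_plane) ?adj_path // doubleK.
  rewrite /crossing /= jm /delta eqxx.
  rewrite [_ == v j.*2.+1]eq_sym (negPf (adj_neq G_plane (adj_path km))) /=.
  by rewrite subr0 !mulr1.
have absE j : `|q (inner_face j)| = `|partial_shift x0 j|.
  by rewrite -crossE crossingE // normrM normrX normrN1 expr1n mul1r.
have [s s0 sE] := partial_shift_sign x0.
have : \sum_(i < m.+1) `|q (inner_face (i + b))| * root_shift i = 0.
  apply: (face_balance_closed (q := fun f => `|q f|)) => e eE eT.
  have := q_off e eE eT; move: eE; rewrite inE => /andP[_ /edgesP[x [y [xy ->]]]] /eqP.
  by rewrite face_diff_eq0 // => /eqP qxy; apply/eqP; rewrite face_diff_eq0 // qxy.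
under eq_bigr do rewrite absE sE -mulrA.
by rewrite -mulr_sumr => /eqP; rewrite mulf_eq0 (negPf s0) => /eqP.
Qed.

(** Summed over all components, the partial sums have the full root shifts as increments, so the
    orthogonality relation becomes the telescoping quadratic identity. *)
Lemma root_shift_eq0 i : root_shift i = 0.
Proof.
pose c j := \sum_x0 partial_shift x0 j.
have cS (k : 'I_m.+1) : c k.+1 - c k = root_shift k.
  rewrite -sumrB; under eq_bigr do rewrite partial_shiftS.
  rewrite -mulr_suml (bigD1 (fingraph.root (set_linked T) (root_vertex k))) //=.
  rewrite inE eqxx big1 ?addr0 ?mul1r // => x; rewrite inE eq_sym => /negPf -> //.
have c0 : forall j, (j <= m.+1)%N -> c j = 0.
  apply: (@closed_telescope_eq0 _ _ _ b).
  - by apply: big1 => x _; apply: partial_shift0.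
  - by apply: big1 => x _; apply: partial_shift_last.
  under eq_bigr do rewrite cS mulr_suml.
  by rewrite exchange_big big1 // => x _; apply: partial_shift_orthogonal.
by rewrite -cS !c0 ?subr0 //; have := ltn_ord i; lia.
Qed.

(** With equal root choices the flow is a circulation on [T], hence the coboundary of a face
    function constant across all edges outside [T], and such a function is zero. *)
Lemma vertex_flow_eq0 e : e \in T -> vertex_flow e = 0.
Proof.
pose z e := if e \in T then vertex_flow e else 0.
have [p|q qo qE] := @closed_is_face_diff _ G_plane G_conn (v 1) z.
  rewrite -[RHS](vertex_balance p) [X in _ = _ + X]big1 ?addr0; last first.
    by move=> i _; rewrite root_shift_eq0 mulr0.
  rewrite (bigID (mem T)) /= [X in _ + X]big1 ?addr0; last first.
    by move=> e' /andP[_ eT]; rewrite /z (negPf eT) mulr0.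
  apply: eq_big => [e'|e' /andP[_ eT]]; first by rewrite andb_idl //; apply: vertex_matched_edges.
  by rewrite /z eT vertex_flowE.
have q0 f : q f = 0.
  by apply: (face_potential_eq0 mu_m) => // e' eE eT; rewrite -qE // /z (negPf eT).
move=> eT; have := qE e (vertex_matched_edges eT); rewrite /z eT => ->.
case/edgesP: (vertex_matched_edges eT) => x [y [xy ->]].
by apply/eqP; rewrite face_diff_eq0 // !q0.
Qed.

(** Dually, the face flow is the coboundary of a vertex function constant along [T] and the path,
    hence constant. *)
Lemma face_flow_eq0 e : e \in edges G :\: path_edges -> e \notin T -> face_flow e = 0.
Proof.
pose Y := [set e in edges G :\: path_edges | e \notin T].
pose y e := if e \in Y then face_flow e else 0.
have [q|p pE] := @coclosed_is_vertex_diff _ G_plane G_conn (v 1) y.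
  transitivity (\sum_(i < m.+1) q (inner_face (i + b)) * root_shift i); last first.
    by apply: big1 => i _; rewrite root_shift_eq0 mulr0.
  rewrite -face_balance (bigID (mem Y)) /= [X in _ + X]big1 ?addr0; last first.
    by move=> e' /andP[_ eY]; rewrite /y (negPf eY) mulr0.
  apply: eq_big => [e'|e' /andP[_ eY]].
    by rewrite !inE; case: (e' \in edges G); rewrite ?andbF ?andbT.
  by rewrite /y eY; move: eY; rewrite inE => /andP[eE eT]; rewrite face_flowE.
have pconst : forall x x', p x = p x'.
  apply: (linked_const mu_m) => e' eTP; rewrite -pE ?(linked_edges eTP) // /y ifN //.
  by move: eTP; rewrite !inE -/T; case: (e' \in path_edges); rewrite ?andbF ?orbF //= => ->; rewrite andbF.
move=> eE eT; have eY : e \in Y by rewrite inE eE.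
move: eE; rewrite inE => /andP[_ eE]; have := pE e eE; rewrite /y eY => ->.
case/edgesP: eE => x [x' [xx' ->]].
by apply/eqP; rewrite vertex_diff_eq0 // (pconst x x').
Qed.

Lemma matching_unique : {in columns, mu =1 nu}.
Proof.
move=> [e|i] cC; last first.
  have := root_shift_eq0 i; rewrite /root_shift /at_root.
  have := matching_incidence mu_m cC; have := matching_incidence nu_m cC.
  by case: (mu _) => [x|f]; case: (nu _) => [x'|f'] //= /eqP -> /eqP ->.
move: cC; rewrite inE => eE; case: (boolP (e \in T)) => eT.
  have [x [y [mux nuy xe ye]]] := T_ends eT; have := vertex_flow_eq0 eT.
  rewrite /vertex_flow mux nuy; case: eqVneq => [-> //|xy].
  have [axy ->] := edge_ends G_plane (vertex_matched_edges eT) xe ye xy.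
  by move=> /eqP; rewrite vertex_diff_eq0 // /delta eqxx [y == x]eq_sym (negPf xy).
have [f [g [muf nug fe ge]]] := face_ends eE eT; have := face_flow_eq0 eE eT.
rewrite /face_flow muf nug; case: eqVneq => [-> //|fg].
move: eE; rewrite inE => /andP[_ /edgesP[s [t [st eE]]]]; rewrite eE in fe ge *.
move: fe ge => /(edge_on_boundaryP G_plane _ st) fE /(edge_on_boundaryP G_plane _ st) gE.
move=> /eqP; rewrite face_diff_eq0 // /delta.
have gf : g == f = false by rewrite eq_sym (negPf fg).
by case: fE gE => fE [] gE; rewrite -?fE -?gE ?eqxx ?gf //; rewrite fE gE eqxx in fg.
Qed.

End TwoMatchings.

End PathSystem.

(** * Perfect matchings of the trimmed dual refinement *)

Section Bipartite.
Variables (K : graph) (A B : finType) (X : {set A}) (Y : {set B}).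
Variables (src : A -> carrier K) (tgt : B -> carrier K) (inc : A -> B -> bool).
Hypothesis src_inj : {in X &, injective src}.
Hypothesis tgt_inj : {in Y &, injective tgt}.
Hypothesis src_tgt : {in X & Y, forall a c, src a != tgt c}.
Hypothesis vertsE : verts K = src @: X :|: tgt @: Y.
Hypothesis link_lr : {in X & Y, forall a c, link (src a) (tgt c) = inc a c}.
Hypothesis link_rl : {in X & Y, forall a c, link (tgt c) (src a) = inc a c}.
Hypothesis link_ll : {in X &, forall a a', link (src a) (src a') = false}.
Hypothesis link_rr : {in Y &, forall c c', link (tgt c) (tgt c') = false}.

Let src_verts a : a \in X -> src a \in verts K.
Proof. by move=> aX; rewrite vertsE; apply/setUP; left; apply: imset_f. Qed.

Let tgt_verts c : c \in Y -> tgt c \in verts K.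
Proof. by move=> cY; rewrite vertsE; apply/setUP; right; apply: imset_f. Qed.

Definition pairing (mu : A -> B) : {set {set carrier K}} :=
  [set [set src a; tgt (mu a)] | a in X].

Lemma pairing_perfect mu : {in X &, injective mu} ->
  {in X, forall a, mu a \in Y} -> {in X, forall a, inc a (mu a)} ->
  {in Y, forall c, exists2 a, a \in X & mu a = c} ->
  pairing mu \in perfect_matchings K.
Proof.
move=> mu_inj muY mu_inc mu_onto; rewrite inE; apply/andP; split; last first.
  apply/subsetP => _ /imsetP[a aX ->]; apply/edge_setP; have mY := muY a aX.
  by exists (src a), (tgt (mu a)); rewrite src_verts ?tgt_verts ?link_lr ?mu_inc.
apply/and3P; split.
- rewrite vertsE; apply/eqP/setP => x; apply/bigcupP/setUP.
    move=> [_ /imsetP[a aX ->]]; rewrite in_set2 => /pred2P[]->; [left|right].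
      exact: imset_f.
    by apply: imset_f; apply: muY.
  move=> [] /imsetP[].
    by move=> a aX ->; exists [set src a; tgt (mu a)]; rewrite ?set21 //; apply: imset_f.
  move=> c /mu_onto[a aX <-] ->.
  by exists [set src a; tgt (mu a)]; rewrite ?set22 //; apply: imset_f.
- apply/trivIsetP => _ _ /imsetP[a aX ->] /imsetP[a' a'X ->].
  have [mY m'Y] := (muY a aX, muY a' a'X).
  apply: contraNT => /pred0Pn[x /= /andP[]]; rewrite !in_set2.
  suff aa' : x = src a \/ x = tgt (mu a) -> x = src a' \/ x = tgt (mu a') -> a = a'.
    by move=> /pred2P/aa' {}aa' /pred2P/aa' ->.
  move=> [] -> [].
  + exact: src_inj.
  + by move=> E; have := src_tgt aX m'Y; rewrite E eqxx.
  + by move=> E; have := src_tgt a'X mY; rewrite E eqxx.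
  + by move=> /tgt_inj/mu_inj; apply.
by apply/imsetP => -[a aX] /setP/(_ (src a)); rewrite !inE eqxx.
Qed.

Lemma perfect_pairing (c0 : B) P : P \in perfect_matchings K -> exists mu : A -> B,
  [/\ {in X &, injective mu}, {in X, forall a, mu a \in Y},
      {in X, forall a, inc a (mu a)}, {in Y, forall c, exists2 a, a \in X & mu a = c} &
      P = pairing mu].
Proof.
rewrite inE => /andP[/and3P[/eqP coverP /trivIsetP trivP _] /subsetP Pedges].
have uniq_block D D' x : D \in P -> D' \in P -> x \in D -> x \in D' -> D = D'.
  move=> DP D'P xD xD'; apply/eqP/negPn/negP => /(trivP D D' DP D'P)/pred0P/(_ x).
  by rewrite /= xD xD'.
have blockP D : D \in P -> exists a c, [/\ a \in X, c \in Y, inc a c & D = [set src a; tgt c]].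
  move=> /Pedges/edge_setP[x [y [+ + + ->]]]; rewrite vertsE.
  move=> /setUP[]/imsetP[a aX ->] /setUP[]/imsetP[c cY ->].
  - by rewrite link_ll.
  - by rewrite link_lr // => ac; exists a, c.
  - by rewrite link_rl // => ac; exists c, a; rewrite setUC.
  - by rewrite link_rr.
have block_of x : x \in verts K -> exists2 D, D \in P & x \in D.
  by rewrite -coverP => /bigcupP[D]; exists D.
(* The default [c0] is never taken on [X], where [block_of] provides a partner. *)
pose mu a := odflt c0 [pick c in Y | inc a c && ([set src a; tgt c] \in P)].
have muP a : a \in X -> [/\ mu a \in Y, inc a (mu a) & [set src a; tgt (mu a)] \in P].
  move=> aX; have [|D DP aD] := block_of (src a); first exact: src_verts.
  have [a' [c [a'X cY ac DE]]] := blockP D DP.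
  move: aD; rewrite DE in_set2 => /pred2P[/src_inj aa'|E]; last first.
    by have := src_tgt aX cY; rewrite E eqxx.
  rewrite -(aa' aX a'X) in ac DE.
  rewrite /mu; case: pickP => [c' /and3P[] //|/(_ c)].
  by rewrite cY ac -DE DP.
exists mu; split.
- move=> a a' aX a'X mE; have [mY _ aP] := muP a aX; have [_ _ a'P] := muP a' a'X.
  have E : [set src a; tgt (mu a)] = [set src a'; tgt (mu a')].
    by apply: (uniq_block _ _ (tgt (mu a))); rewrite // ?mE set22.
  have := set21 (src a) (tgt (mu a)); rewrite E in_set2 => /pred2P[/src_inj->//|E'].
  by have := src_tgt aX mY; rewrite E' mE eqxx.
- by move=> a /muP[].
- by move=> a /muP[].
- move=> c cY; have [|D DP cD] := block_of (tgt c).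
    exact: tgt_verts.
  have [a [c' [aX c'Y _ DE]]] := blockP D DP; have [mY _ aP] := muP a aX; exists a => //.
  have E : D = [set src a; tgt (mu a)].
    by apply: (uniq_block _ _ (src a)); rewrite // ?DE set21.
  move: cD; rewrite E in_set2 => /pred2P[E'|/tgt_inj -> //].
  by have := src_tgt aX cY; rewrite E' eqxx.
apply/setP => D; apply/idP/imsetP => [DP|[a aX ->]]; last by have [] := muP a aX.
have [a [c [aX _ _ DE]]] := blockP D DP; exists a => //; have [_ _ aP] := muP a aX.
by apply: (uniq_block _ _ (src a)); rewrite // ?DE set21.
Qed.

End Bipartite.

(** * Identification of G^+ and G^- with the path system on G_0 *)

Section Translation.
Variables (G : drawing) (m : nat) (v : nat -> G) (u : G) (w : option G).
Hypothesis G_plane : plane G.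
Hypothesis v_inj : {in [pred j | 0 < j < m.+1.*2] &, injective v}.
Hypothesis v_path : forall j, 0 < j -> j.+1 < m.+1.*2 -> adj (v j) (v j.+1).
Hypothesis v1_outer : vertex_on_boundary (outer G) (v 1).
Hypothesis e_outer : forall j, 0 < j -> j.+1 < m.+1.*2 ->
  edge_on_boundary (outer G) [set v j; v j.+1].
Hypothesis v_even : forall i, 0 < i -> i < m.+1 -> degree (v i.*2) = 2.
Hypothesis u_outer : side u (v 1) = outer G.
Hypothesis w_outer : @side (one_leaf v u) w (Some (v m.+1.*2.-1)) = outer (one_leaf v u).

Local Notation H := (two_leaves m.+1 v u w).
Local Notation ext := (extended_path m.+1 v u w).

Definition lift_vertex (x : G) : H := Some (Some x).
Definition lift_edge (e : {set G}) : {set H} := lift_vertex @: e.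
(** Numbered from 0, so that m_(j+1) is the edge-vertex of [extended_edge j] and the leaf edges are
    the numbers 0 and 2m + 1. *)
Definition extended_edge (j : nat) : {set H} := [set ext j; ext j.+1].

Lemma lift_vertex_inj : injective lift_vertex.
Proof. by move=> x y []. Qed.

Lemma lift_edge_inj : injective lift_edge.
Proof. exact/imset_inj/lift_vertex_inj. Qed.

Lemma lift_edge2 x y : lift_edge [set x; y] = [set lift_vertex x; lift_vertex y].
Proof. by rewrite /lift_edge imsetU !imset_set1. Qed.

Lemma ext_inner j : 0 < j < m.+1.*2 -> ext j = lift_vertex (v j).
Proof.
move=> /andP[j0 jm]; rewrite /extended_path.
by rewrite (gtn_eqF j0) (ltn_eqF jm).
Qed.


Lemma ext_last : ext m.+1.*2 = None.
Proof. by rewrite /extended_path eqxx. Qed.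

Lemma ext_inj j k : j <= m.+1.*2 -> k <= m.+1.*2 -> ext j = ext k -> j = k.
Proof.
have extP i : i <= m.+1.*2 -> [\/ i = 0 /\ ext i = Some None,
    i = m.+1.*2 /\ ext i = None | 0 < i < m.+1.*2 /\ ext i = lift_vertex (v i)].
  case: (posnP i) => [-> _|i0]; first by constructor 1.
  rewrite leq_eqVlt => /orP[/eqP ->|im]; first by constructor 2; rewrite ext_last.
  by constructor 3; rewrite ext_inner ?i0.
move=> /extP[][jE ->] /extP[][kE ->] //; rewrite ?jE ?kE //.
by move=> [/v_inj]; rewrite !inE; apply.
Qed.

Lemma extended_edge_inj j k : j < m.+1.*2 -> k < m.+1.*2 ->
  extended_edge j = extended_edge k -> j = k.
Proof.
move=> jm km; have jj : ext j != ext j.+1 by apply/eqP => /ext_inj; lia.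
move=> /(eq_set2 jj)[][]; first by move=> /ext_inj jk _; apply: jk; apply: ltnW.
by move=> /ext_inj jk /ext_inj kj; have := jk _ _; have := kj _ _; lia.
Qed.

Lemma extended_edge_path k : k < m.*2 -> extended_edge k.+1 = lift_edge (path_edge v k).
Proof.
by move=> km; rewrite /extended_edge !ext_inner ?lift_edge2 // doubleS; lia.
Qed.

Lemma adj_lift x y : @adj H (lift_vertex x) (lift_vertex y) = adj x y.
Proof. by []. Qed.

Lemma side_lift x y : @side H (lift_vertex x) (lift_vertex y) = side x y.
Proof. by []. Qed.

Lemma H_adjP (s t : H) : @adj H s t ->
  (exists x y, [/\ s = lift_vertex x, t = lift_vertex y & adj x y]) \/
  (([set s; t] = extended_edge 0 \/ [set s; t] = extended_edge m.*2.+1) /\ side s t = outer G).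
Proof.
have e0 : extended_edge 0 = [set Some None; lift_vertex (v 1)] by [].
have e1 : extended_edge m.*2.+1 = [set lift_vertex (v m.*2.+1); None].
  rewrite /extended_edge ext_inner; last by rewrite doubleS; lia.
  by rewrite -[m.*2.+2]/(m.+1.*2) ext_last.
rewrite e0 e1; case: s t => [[x|]|] [[y|]|] //=.
- by left; exists x, y.
- by move=> /eqP ->; right; rewrite setUC; split=> //; left.
- by move=> /eqP [->]; right; split=> //; right.
- by move=> /eqP ->; right; split=> //; left.
- by move=> /eqP [->]; right; rewrite setUC; split=> //; right.
Qed.

Definition leaf_edge (E : {set H}) := E = extended_edge 0 \/ E = extended_edge m.*2.+1.

Lemma lift_edge_not_leaf e : ~ leaf_edge (lift_edge e).
Proof.
case=> E.
  have : Some None \in lift_edge e by rewrite E set21.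
  by case/imsetP.
have : ext m.+1.*2 \in lift_edge e by rewrite E set22.
by rewrite ext_last; case/imsetP.
Qed.

Lemma edge_on_boundary_lift (f : face G) e :
  edge_on_boundary (f : face H) (lift_edge e) = edge_on_boundary f e.
Proof.
apply/existsP/existsP => -[s /existsP[t /and3P[st /eqP eE sf]]]; last first.
  exists (lift_vertex s); apply/existsP; exists (lift_vertex t).
  by rewrite side_lift adj_lift st sf eE lift_edge2 eqxx.
have [[x [y [sx ty xy]]]|[leaf _]] := H_adjP st.
  exists x; apply/existsP; exists y; rewrite xy -(side_lift x y) -sx -ty sf andbT.
  by apply/eqP/lift_edge_inj; rewrite eE sx ty lift_edge2.
by case: (@lift_edge_not_leaf e); rewrite eE.
Qed.

Lemma edge_on_boundary_leaf (f : face G) E : leaf_edge E ->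
  edge_on_boundary (f : face H) E -> f = outer G.
Proof.
move=> leafE /existsP[s /existsP[t /and3P[st /eqP eE /eqP <-]]].
have [[x [y [sx ty xy]]]|[_ //]] := H_adjP st.
by case: (@lift_edge_not_leaf [set x; y]); rewrite lift_edge2 -sx -ty -eE.
Qed.

Lemma edges_HP (E : {set H}) : reflect
  ((exists2 e, e \in edges G :\: path_edges m v & E = lift_edge e) \/
   (exists2 j, j < m.+1.*2 & E = extended_edge j)) (E \in edges H).
Proof.
apply: (iffP (edge_setP _ _ _)) => [[s [t [_ _ st ->]]]|].
  have [[x [y [sx ty xy]]]|[[]->]] := H_adjP st; last 2 first.
  - by right; exists 0.
  - by right; exists m.*2.+1; rewrite ?doubleS.
  rewrite sx ty -lift_edge2; case: (boolP ([set x; y] \in path_edges m v)) => [/imsetP[k _ ->]|xyP].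
    by right; exists k.+1; rewrite ?extended_edge_path //; have := ltn_ord k; lia.
  by left; exists [set x; y]; rewrite // inE xyP adj_edges.
case=> [[e + ->]|[j jm ->]].
  rewrite inE => /andP[_ /edge_setP[x [y [_ _ xy ->]]]].
  by exists (lift_vertex x), (lift_vertex y); rewrite lift_edge2 !inE adj_lift.
exists (ext j), (ext j.+1); split; rewrite ?inE //.
case: (posnP j) => [->|j0]; first by rewrite /= eqxx.
move: jm; rewrite leq_eqVlt => /orP[/eqP jm|jm].
  have -> : j = m.*2.+1 by lia.
  rewrite ext_inner; last by lia.
  by rewrite -[m.*2.+2]/(m.+1.*2) ext_last /= eqxx.
by rewrite !ext_inner ?adj_lift ?v_path //; lia.
Qed.

Definition column_vertex (b : bool) (c : {set G} + 'I_m.+1) : refinement_vertex H :=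
  match c with
  | inl e => edge_vertex (lift_edge e)
  | inr i => edge_vertex (extended_edge (i.*2 + b))
  end.

Definition node_vertex (x : G + face G) : refinement_vertex H :=
  match x with
  | inl y => original_vertex (lift_vertex y)
  | inr f => @face_vertex H f
  end.

Definition trimmed (b : bool) : graph :=
  @delete_vertices (dual_refinement H) (even_path_vertices m.+1 v u w
    :|: [set edge_vertex (extended_edge (i.*2 + ~~ b)) | i : 'I_m.+1]).

Lemma trimmed_Gplus : Gplus m.+1 v u w = trimmed true.
Proof.
rewrite /Gplus /trimmed; congr (delete_vertices (_ :|: _)).
by apply: eq_imset => i; rewrite addn0.
Qed.

Lemma trimmed_Gminus : Gminus m.+1 v u w = trimmed false.
Proof.
rewrite /Gminus /trimmed; congr (delete_vertices (_ :|: _)).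
by apply: eq_imset => i; rewrite addn1.
Qed.

Lemma trimmed_verts b (x : refinement_vertex H) : (x \in verts (trimmed b)) =
  match x with
  | inl (inl s) => [forall i : 'I_m.+2, s != ext i.*2]
  | inl (inr f) => f != outer G
  | inr E => (E \in edges H) && [forall i : 'I_m.+1, E != extended_edge (i.*2 + ~~ b)]
  end.
Proof.
have original_inj : injective (@original_vertex H) by move=> ? ? [].
have face_inj : injective (@face_vertex H) by move=> ? ? [].
have edge_inj : injective (@edge_vertex H) by move=> ? ? [].
rewrite in_setD !in_setU; case: x => [[s|f]|E].
- rewrite (mem_imset _ _ original_inj) /= andbT.
  rewrite negb_or; apply/andP/forallP => [[sE _] i|sE].
    by apply: contra sE => /eqP ->; apply: imset_f.
  split; apply/imsetP => -[i _] // [] /eqP; apply/negP; exact: sE.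
- rewrite (mem_imset _ _ face_inj) inE.
  have -> : inl (inr f) \in even_path_vertices m.+1 v u w = false by apply/imsetP => -[].
  have -> : inl (inr f) \in [set original_vertex x | x : H] = false by apply/imsetP => -[].
  have -> : inl (inr f) \in [set edge_vertex e | e in edges H] = false by apply/imsetP => -[].
  rewrite orbF; case: (f != _); rewrite ?andbF // andbT.
  by apply/imsetP => -[].
rewrite (mem_imset _ _ edge_inj).
have -> : inr E \in even_path_vertices m.+1 v u w = false by apply/imsetP => -[].
have -> : inr E \in [set original_vertex x | x : H] = false by apply/imsetP => -[].
have -> : inr E \in [set face_vertex f | f in [pred f | f != outer H]] = false.
  by apply/imsetP => -[].
rewrite andbC; congr (_ && _) => /=; apply/idP/forallP => [/imsetP EP i|EP].
  by apply/eqP => EE; apply: EP; exists i; rewrite // EE.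
by apply/imsetP => -[i _ [] /eqP]; apply/negP/EP.
Qed.

Local Notation columns := (columns m v).
Local Notation nodes := (nodes m v).

Lemma even_verticesP y : reflect (exists2 i, i < m & y = v i.*2.+2) (y \in even_vertices m v).
Proof.
apply: (iffP imsetP) => [[i _ ->]|[i im ->]]; first by exists i.
by exists (Ordinal im).
Qed.

Lemma trimmed_vertsE b : verts (trimmed b) =
  column_vertex b @: columns :|: node_vertex @: nodes.
Proof.
apply/setP => x; rewrite trimmed_verts in_setU; case: x => [[s|f]|E].
- have -> : inl (inl s) \in column_vertex b @: columns = false.
    by apply/imsetP => -[[]].
  apply/forallP/imsetP => [sE|[[y|f] // yN [->]] i].
    case: s sE => [[y|]|] sE; first last.
    + by have := sE ord_max; rewrite -[nat_of_ord _]/m.+1 ext_last eqxx.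
    + by have := sE ord0; rewrite eqxx.
    exists (inl y) => //; rewrite !inE; apply/even_verticesP => -[i im yE].
    have := sE (inord i.+1); rewrite inordK; last by lia.
    by rewrite ext_inner ?yE ?eqxx // !doubleS; lia.
  apply/eqP => yE; move: yN; rewrite !inE => /even_verticesP[].
  case: (posnP i) => [i0|i0]; first by move: yE; rewrite i0.
  have := ltn_ord i; rewrite ltnS leq_eqVlt => /orP[/eqP im|im].
    by move: yE; rewrite im ext_last.
  move: yE; rewrite ext_inner; last by lia.
  by move=> [->]; exists i.-1; rewrite -?doubleS ?prednK //; move: im i0; lia.
- have -> : inl (inr f) \in column_vertex b @: columns = false.
    by apply/imsetP => -[[]].
  apply/idP/imsetP => [fo|[[y|g] // gN [->]]]; last by rewrite !inE in gN.
  by exists (inr f); rewrite ?inE.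
have -> : inr E \in node_vertex @: nodes = false by apply/imsetP => -[[]].
rewrite orbF; apply/andP/imsetP => [[/edges_HP[[e eE ->]|[j jm ->]] /forallP Eb]|[[e|i] eC [->]]].
- by exists (inl e); rewrite ?inE -?in_setD.
(* The other parity is deleted, so j = 2 (j / 2) + b. *)
- have jm2 : j./2 < m.+1 by lia.
  exists (inr (Ordinal jm2)); rewrite ?inE //=; congr (edge_vertex (extended_edge _)).
  have := Eb (Ordinal jm2); rewrite -{1 3}(odd_double_half j) addnC /=.
  by case: (odd j); case: (b); rewrite ?eqxx.
- split; first by apply/edges_HP; left; exists e; rewrite // inE in eC.
  apply/forallP => i; apply/eqP => eE; have := ltn_ord i => im.
  suff ePE : e \in path_edges m v by move: eC; rewrite inE in_setD ePE.
  have i2 : i.*2 + ~~ b < m.+1.*2 by case: (b); lia.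
  case: (posnP (i.*2 + ~~ b)) => [i0|i0].
    by case: (@lift_edge_not_leaf e); left; rewrite eE i0.
  move: (i.*2 + ~~ b) i2 i0 eE => [//|k] km _ eE.
  have [k2|k2] := ltnP k m.*2.
    rewrite extended_edge_path // in eE; rewrite (lift_edge_inj eE).
    exact: (imset_f _ (x := Ordinal k2)).
  by case: (@lift_edge_not_leaf e); right; rewrite eE; congr extended_edge; lia.
have im := ltn_ord i; split.
  by apply/edges_HP; right; exists (i.*2 + b) => //; case: (b); lia.
apply/forallP => j; apply/eqP => /extended_edge_inj; have jm := ltn_ord j.
by case: (b) => /= /(_ _ _); lia.
Qed.

Lemma column_vertex_inj b : {in columns &, injective (column_vertex b)}.
Proof.
have cross e i : e \notin path_edges m v -> i < m.+1 -> lift_edge e <> extended_edge (i.*2 + b).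
  move=> /negP ePE im eE; apply: ePE.
  have i2 : i.*2 + b < m.+1.*2 by case: (b); lia.
  move: (i.*2 + b) i2 eE => [|k] km eE; first by case: (@lift_edge_not_leaf e); left.
  have [k2|k2] := ltnP k m.*2.
    rewrite extended_edge_path // in eE; rewrite (lift_edge_inj eE).
    exact: (imset_f _ (x := Ordinal k2)).
  by case: (@lift_edge_not_leaf e); right; rewrite eE; congr extended_edge; lia.
move=> [e|i] [e'|i'] cC c'C [].
- by move=> /lift_edge_inj ->.
- by move: cC; rewrite inE in_setD => /andP[eP _] /cross; case=> //; case: (i').
- by move: c'C; rewrite inE in_setD => /andP[eP _] /esym/cross; case=> //; case: (i).
have im := ltn_ord i; have i'm := ltn_ord i'; move=> /extended_edge_inj ii'.
by congr inr; apply/val_inj; have := ii' _ _; case: (b) => /= /(_ _ _); lia.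
Qed.

Lemma node_vertex_inj : injective node_vertex.
Proof. by move=> [x|f] [y|g] // []; [move=> ->|move=> ->]. Qed.

(** A surviving edge of the extended path keeps one end, the other having even index. It borders at
    most one bounded face because the outer face lies on one of its sides; a leaf edge borders no
    bounded face. *)
Lemma refinement_incidence b c x : c \in columns -> x \in nodes ->
  refinement_adj (column_vertex b c) (node_vertex x) = incidence v b c x.
Proof.
case: c x => [e|i] [y|f] cC xN /=.
- by rewrite (mem_imset _ _ lift_vertex_inj).
- exact: edge_on_boundary_lift.
- have liftE z k : 0 < k < m.+1.*2 -> (lift_vertex z == ext k) = (z == v k).
    by move=> km; rewrite ext_inner // (inj_eq lift_vertex_inj).
  have yE k : k < m -> (y == v k.*2.+2) = false.
    move=> km; apply/negbTE; move: xN; rewrite !inE; apply: contra => /eqP ->.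
    by apply/even_verticesP; exists k.
  have im := ltn_ord i; rewrite in_set2 /root_vertex; case: (b).
    rewrite addn1 liftE; last by lia.
    rewrite ltnS leq_eqVlt in im; case/orP: im => [/eqP ->|im].
      by rewrite -[m.*2.+2]/(m.+1.*2) ext_last orbF.
    by rewrite liftE ?yE ?orbF //; lia.
  rewrite addn0 [X in _ || X]liftE; last by lia.
  (* For i = 0 the deleted end is the leaf v_0, otherwise the even path vertex before the root. *)
  case: (posnP i) => [->//|i0]; rewrite liftE; last by lia.
  have -> : i.*2 = i.-1.*2.+2 by lia.
  by rewrite yE //; lia.
have fo : f != outer G by move: xN; rewrite !inE.
have boundary_path := edge_on_boundary_path G_plane v_inj v_path v1_outer e_outer v_even.
have leaf_false E : leaf_edge E -> edge_on_boundary (f : face H) E = false.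
  by move=> leafE; apply/negbTE; apply: contra fo => /(edge_on_boundary_leaf leafE) ->.
have im := ltn_ord i; rewrite ltnS leq_eqVlt in im; case: (b).
  rewrite !addn1; case/orP: im => [/eqP ->|im].
    rewrite leaf_false; last by right.
    by rewrite /inner_face ltnn andbF (negPf fo).
  rewrite extended_edge_path; last by lia.
  by rewrite edge_on_boundary_lift boundary_path // ?doubleK //; lia.
rewrite !addn0; case: (posnP i) => [->|i0].
  by rewrite leaf_false ?(negPf fo) //; left.
have -> : i.*2 = i.-1.*2.+2 by lia.
rewrite extended_edge_path; last by move: im; lia.
rewrite edge_on_boundary_lift boundary_path //; last by move: im; lia.
by rewrite /= uphalf_double prednK.
Qed.

Definition matching_set b (mu : {set G} + 'I_m.+1 -> G + face G) :
    {set {set refinement_vertex H}} :=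
  @pairing (trimmed b) _ _ columns (column_vertex b) node_vertex mu.

Lemma column_node b : {in columns & nodes, forall c x, column_vertex b c != node_vertex x}.
Proof. by move=> [e|i] [y|f]. Qed.

(** Connectedness comes from the count [card_nodes]: for a disconnected G_0 the trimmed graphs have
    no perfect matching. *)
Lemma perfect_matchingsP b P : P \in perfect_matchings (trimmed b) ->
  n_components G = 1 /\ exists2 mu, matching v b mu & P = matching_set b mu.
Proof.
move=> PM.
have [||||||||mu [mu_inj muN mu_inc mu_onto ->]] :=
  @perfect_pairing (trimmed b) _ _ columns nodes (column_vertex b) node_vertex
    (incidence v b) _ _ _ _ _ _ _ _ (inl (v 1)) P PM.
- exact: column_vertex_inj.
- exact: in2W node_vertex_inj.
- exact: column_node.
- exact: trimmed_vertsE.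
- by move=> c x cC xN; apply: refinement_incidence.
- by move=> c x cC xN; rewrite -(refinement_incidence b cC xN); case: (c) (x) => [?|?] [?|?].
- by move=> [?|?] [?|?].
- by move=> [?|?] [?|?].
split; last by exists mu.
have muE : mu @: columns = nodes.
  apply/setP => x; apply/imsetP/idP => [[c cC ->]|/mu_onto[c cC <-]]; first exact: muN.
  by exists c.
have := card_nodes G_plane v_inj v_path v1_outer; rewrite -muE (card_in_imset mu_inj).
by move=> /eqP; rewrite eqn_add2l => /eqP.
Qed.

Lemma matching_set_perfect b mu : n_components G = 1 -> matching v b mu ->
  matching_set b mu \in perfect_matchings (trimmed b).
Proof.
move=> G_conn mu_m; have [mu_inj muN mu_inc] := mu_m.
apply: (@pairing_perfect (trimmed b) _ _ columns nodes _ _ (incidence v b)) => //.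
- exact: column_vertex_inj.
- exact: in2W node_vertex_inj.
- exact: column_node.
- exact: trimmed_vertsE.
- by move=> c x cC xN; apply: refinement_incidence.
- by move=> x xN; apply: (matching_onto G_plane v_inj v_path v1_outer G_conn mu_m).
Qed.

(** The type T read off from the set of pairs itself, so that one map serves both graphs. *)
Definition matched_edges (P : {set {set refinement_vertex H}}) : {set {set G}} :=
  [set e in edges G :\: path_edges m v |
    [exists x, [set edge_vertex (lift_edge e); original_vertex (lift_vertex x)] \in P]].

Lemma matched_edges_set b mu : matching v b mu ->
  matched_edges (matching_set b mu) = vertex_matched v mu.
Proof.
move=> mu_m; apply/setP => e; rewrite !inE -in_setD; case: (boolP (_ \in _)) => //= eE.
have eC : inl e \in columns by rewrite inE.
apply/existsP/idP => [[x /imsetP[c cC E]]|].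
  have : edge_vertex (lift_edge e) \in [set column_vertex b c; node_vertex (mu c)].
    by rewrite -E set21.
  rewrite in_set2 => /orP[/eqP cE|/eqP]; last by case: (mu c).
  have {}cE : inl e = c by apply: (@column_vertex_inj b).
  have : original_vertex (lift_vertex x) \in [set column_vertex b c; node_vertex (mu c)].
    by rewrite -E set22.
  by rewrite in_set2 -cE => /orP[/eqP//|]; case: (mu (inl e)).
case E : (mu (inl e)) => [x|//] _; exists x; apply/imsetP; exists (inl e) => //.
by rewrite E.
Qed.

Lemma matched_edges_inj b : {in perfect_matchings (trimmed b) &, injective matched_edges}.
Proof.
move=> P Q /perfect_matchingsP[G_conn [mu mu_m ->]] /perfect_matchingsP[_ [nu nu_m ->]].
rewrite !matched_edges_set // => T_eq.
apply: eq_in_imset => c cC.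
by rewrite (matching_unique G_plane v_inj v_path v1_outer e_outer v_even G_conn mu_m nu_m).
Qed.

(** Every type realised in one graph is realised in the other; with injectivity of the type this
    gives equal counts. *)
Lemma matched_edges_sub b b' :
  matched_edges @: perfect_matchings (trimmed b) \subset
    matched_edges @: perfect_matchings (trimmed b').
Proof.
apply/subsetP => _ /imsetP[P /perfect_matchingsP[G_conn [mu mu_m ->]] ->].
have [nu nu_m nuE] :=
  matching_shift G_plane v_inj v_path v1_outer e_outer v_even G_conn b' mu_m.
apply/imsetP; exists (matching_set b' nu); first exact: matching_set_perfect.
by rewrite !matched_edges_set.
Qed.

Lemma trimmed_matchings : M (Gplus m.+1 v u w) = M (Gminus m.+1 v u w).
Proof.
rewrite trimmed_Gplus trimmed_Gminus /M.
rewrite -(card_in_imset (@matched_edges_inj true)) -(card_in_imset (@matched_edges_inj false)).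
by apply/eqP; rewrite eqn_leq !subset_leq_card ?matched_edges_sub.
Qed.

End Translation.

Theorem theorem2p1 (G0 : drawing) (n : nat) (v : nat -> G0)
    (u : G0) (w : option G0)
    (G0_plane : plane G0)
    (n_gt0 : 0 < n)
    (v_inj : {in [pred j | 0 < j < n.*2] &, injective v})
    (v_path : forall j, 0 < j -> j.+1 < n.*2 -> adj (v j) (v j.+1))
    (v_outer : forall j, 0 < j -> j < n.*2 ->
       vertex_on_boundary (outer G0) (v j))
    (e_outer : forall j, 0 < j -> j.+1 < n.*2 ->
       edge_on_boundary (outer G0) [set v j; v j.+1])
    (v_even : forall i, 0 < i -> i < n -> degree (v i.*2) = 2)
    (u_corner : corner (v 1) u)
    (u_outer : side u (v 1) = outer G0)
    (w_corner : @corner (one_leaf v u) (Some (v n.*2.-1)) w)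
    (w_outer : @side (one_leaf v u) w (Some (v n.*2.-1)) =
               outer (one_leaf v u))
    (G_leaves : no_leaf_in_bounded_face (two_leaves n v u w)) :
  (exists phi : {P | P \in perfect_matchings (Gplus n v u w)} ->
                {P | P \in perfect_matchings (Gminus n v u w)},
     bijective phi) /\
  M (Gplus n v u w) = M (Gminus n v u w).
Proof.
case: n => [//|m] in n_gt0 v_inj v_path v_outer e_outer v_even w_corner w_outer G_leaves *.
suff card_eq : M (Gplus m.+1 v u w) = M (Gminus m.+1 v u w).
  by split=> //; apply: card_bijection.
by apply: trimmed_matchings => //; apply: v_outer.
Qed.
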